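(* Let $(\mathscr{E},\mathscr{M})$ be a suitable factorization system on a category $\mathscr{C}$. The locally preordered bicategory $\mathrm{Spn}(\mathscr{E},\mathscr{M})$ is rendered fake pullback ready by the factorization system $(\mathscr{E}^*,\mathscr{M}_* )$; that is, with $\mathscr{U}=\mathscr{E}^*$ and $\mathscr{L}=\mathscr{M}_*$, the bicategory $\mathrm{Spn}(\mathscr{E},\mathscr{M})$ is fake pullback ready.
   Context: Factorization system $(\mathscr{E},\mathscr{M})$ on a category $\mathscr{C}$: sets of morphisms containing the isomorphisms, closed under composition, with (FS1) if $mu=ve$ with $e\in\mathscr{E}$, $m\in\mathscr{M}$, there is a unique $w$ with $we=u$ and $mw=v$; (FS2) every morphism $f$ factorizes as $f=m\circ e$ with $e\in\mathscr{E}$, $m\in\mathscr{M}$. It is suitable when: (SFS1) pullbacks of arbitrary morphisms along members of $\mathscr{M}$ exist; (SFS2) pushouts of arbitrary morphisms along members of $\mathscr{E}$ exist; (SFS3) the pullback of a member of $\mathscr{E}$ along a member of $\mathscr{M}$ is in $\mathscr{E}$; (SFS4) the pushout of a member of $\mathscr{M}$ along a member of $\mathscr{E}$ is in $\mathscr{M}$; (SFS5) a commutative square $d\circ n=m\circ e$ with $n:D\to B$, $m:A\to C$ in $\mathscr{M}$ and $e:D\to A$, $d:B\to C$ in $\mathscr{E}$ is a pullback if and only if it is a pushout. The bicategory $\mathrm{Spn}(\mathscr{E},\mathscr{M})$ has the objects of $\mathscr{C}$; a morphism $(d,R,m):U\to W$ is a span $U\xleftarrow{d}R\xrightarrow{m}W$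 in $\mathscr{C}$ with $d\in\mathscr{E}$, $m\in\mathscr{M}$; 2-cells are the usual morphisms of spans (morphisms of $\mathscr{C}$ between the apexes commuting with the legs); composition is the usual span composition by pullback. It is locally preordered (at most one 2-cell between parallel morphisms). For $m:X\to Y$ in $\mathscr{M}$ put $m_*=(1_X,X,m):X\to Y$; for $e:X\to Y$ in $\mathscr{E}$ put $e^*=(e,X,1_X):Y\to X$. $\mathscr{M}_*$ is the class of morphisms isomorphic to some $m_*$ with $m\in\mathscr{M}$; $\mathscr{E}^*$ is the class of morphisms isomorphic to some $e^*$ with $e\in\mathscr{E}$. Factorization system $(\mathscr{U},\mathscr{L})$ on a bicategory $\mathscr{S}$: classes of morphisms containing the equivalences, closed under composition and under invertible 2-cells, such that (FS1) for all $e:X\to Y$ in $\mathscr{U}$ and $m:A\to B$ in $\mathscr{L}$, the square of functors (commuting up to the associativity isomorphism) with vertices $\mathscr{S}(Y,A),\mathscr{S}(X,A),\mathscr{S}(Y,B),\mathscr{S}(X,B)$, given by precomposition with $e$ and postcomposition with $m$, is a bipullback; (FS2) every morphism $f$ satisfies $f\cong m\circ e$ for some $e\in\mathscr{U}$, $m\in\mathscr{L}$. A bicategory $\mathscr{S}$ is fake pullback ready when it is locally preordered and equipped with a factorization system $(\mathscr{U},\mathscr{L})$ satisfying: V1. Bipullbacks of morphisms in $\mathscr{U}$ along morphisms in $\mathscr{U}$ exist and have projections in $\mathscr{U}$; bipullbacks of morphisms in $\mathscr{L}$ along morphisms in $\mathscr{L}$ exist and have projections in $\mathscr{L}$. V2.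 Given $X\xrightarrow{a}Z\xleftarrow{x}Y$ with $a\in\mathscr{U}$, $x\in\mathscr{L}$, there exist $b:U\to Y$ in $\mathscr{U}$, $y:U\to X$ in $\mathscr{L}$ and a 2-cell $x\circ b\Rightarrow a\circ y$; this square is unique up to equivalence (any two choices of $(U,b,y)$ are related by an equivalence of the objects $U$ compatible with $b$ and $y$ up to invertible 2-cells). V3. Given $x:X\to Y$, $y:A\to B$, $r:X\to A$, $s:Y\to B$, $t:Z\to C$ in $\mathscr{L}$ and $a:Y\to Z$, $b:B\to C$ in $\mathscr{U}$, such that $s\circ x\cong y\circ r$ is a bipullback square (of $s$ and $y$) and there is a 2-cell $t\circ a\Rightarrow b\circ s$; and given factorizations $a\circ x\cong v\circ c$ (through $I$) and $b\circ y\cong w\circ d$ (through $J$) with $c:X\to I$, $d:A\to J$ in $\mathscr{U}$ and $v:I\to Z$, $w:J\to C$ in $\mathscr{L}$; there exists $q:I\to J$ in $\mathscr{L}$ with a 2-cell $q\circ c\Rightarrow d\circ r$ and with $t\circ v\cong w\circ q$ a bipullback square (of $t$ and $w$). V4. Given $x:X\to Y$, $u:D\to E$ in $\mathscr{L}$ and $h:E\to F$, $a:Y\to Z$, $e:D\to X$, $f:E\to Y$, $g:F\to Z$ in $\mathscr{U}$, such that there is a 2-cell $x\circ e\Rightarrow f\circ u$ and $g\circ h\cong a\circ f$ is a bipullback square (of $g$ and $a$); and given factorizations $h\circ u\cong p\circ k$ (through $K$) and $a\circ x\cong v\circ c$ (through $I$) with $k:D\to K$, $c:X\to I$ in $\mathscr{U}$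 and $p:K\to F$, $v:I\to Z$ in $\mathscr{L}$; there exists $j:K\to I$ in $\mathscr{U}$ with $j\circ k\cong c\circ e$ a bipullback square (of $j$ and $c$) and a 2-cell $v\circ j\Rightarrow g\circ p$. *)

(* Defs.v *)
(* Stdlib only: categories and bicategories are set up from scratch, with
   Leibniz equality of morphisms and of 2-cells. *)
From Stdlib Require Import Classical ClassicalEpsilon.

Set Implicit Arguments.
Unset Strict Implicit.
Unset Printing Implicit Defensive.

Declare Scope cat_scope.
Open Scope cat_scope.

(** * Categories *)

Record Category := {
  ob :> Type;
  hom : ob -> ob -> Type;
  idm : forall x : ob, hom x x;
  compose : forall x y z : ob, hom y z -> hom x y -> hom x z;
  composeA : forall (x y z t : ob) (h : hom z t) (g : hom y z) (f : hom x y),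
    compose (compose h g) f = compose h (compose g f);
  compose1m : forall (x y : ob) (f : hom x y), compose (idm y) f = f;
  composem1 : forall (x y : ob) (f : hom x y), compose f (idm x) = f
}.
Arguments hom {_} _ _.
Arguments idm {_} _.
Arguments compose {_ _ _ _} _ _.

Notation "g ∘ f" := (compose g f) (at level 40, left associativity) : cat_scope.

Record iso (C : Category) (x y : C) := {
  iso_fwd :> hom x y;
  iso_bwd : hom y x;
  iso_bwdK : iso_bwd ∘ iso_fwd = idm x;
  iso_fwdK : iso_fwd ∘ iso_bwd = idm y
}.

Definition isomorphic (C : Category) (x y : C) : Prop := inhabited (iso x y).

Definition is_iso (C : Category) (x y : C) (f : hom x y) : Prop :=
  exists g : hom y x, g ∘ f = idm x /\ f ∘ g = idm y.

Definition iso_sym (C : Category) (x y : C) (i : iso x y) : iso y x :=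
  {| iso_fwd := iso_bwd i; iso_bwd := iso_fwd i;
     iso_bwdK := iso_fwdK i; iso_fwdK := iso_bwdK i |}.

Lemma compose_cancel (C : Category) (x y z : C) (f : hom y z) (g : hom x y)
    (f' : hom z y) (g' : hom y x) :
  f' ∘ f = idm y -> g' ∘ g = idm x -> (g' ∘ f') ∘ (f ∘ g) = idm x.
Proof.
intros Hf Hg.
rewrite composeA, <- (composeA f' f g), Hf, compose1m; exact Hg.
Qed.

Definition iso_comp (C : Category) (x y z : C) (j : iso y z) (i : iso x y) :
    iso x z :=
  {| iso_fwd := iso_fwd j ∘ iso_fwd i; iso_bwd := iso_bwd i ∘ iso_bwd j;
     iso_bwdK := compose_cancel (iso_bwdK j) (iso_bwdK i);
     iso_fwdK := compose_cancel (iso_fwdK i) (iso_fwdK j) |}.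

Record Functor (A B : Category) := {
  fob :> A -> B;
  fmap : forall x y : A, hom x y -> hom (fob x) (fob y);
  fmap1 : forall x : A, fmap (idm x) = idm (fob x);
  fmapM : forall (x y z : A) (g : hom y z) (f : hom x y),
    fmap (g ∘ f) = fmap g ∘ fmap f
}.

Definition is_equivalence_functor (A B : Category) (F : Functor A B) : Prop :=
  (forall (x y : A) (k : hom (F x) (F y)), exists! h : hom x y, fmap F h = k)
  /\ (forall b : B, exists a : A, isomorphic (F a) b).

(** * Bipullbacks of categories *)

(* The square  H F ≅ K G  of functors, commuting up to [nat_square], with
   F : A -> B, G : A -> B', H : B -> D, K : B' -> D. *)
Record nat_square (A B B' D : Category) (F : Functor A B) (G : Functor A B')
    (H : Functor B D) (K : Functor B' D) := {
  nsq_iso :> forall a : A, iso (H (F a)) (K (G a));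
  nsq_nat : forall (a a' : A) (h : hom a a'),
    fmap K (fmap G h) ∘ nsq_iso a = nsq_iso a' ∘ fmap H (fmap F h)
}.

Section IsoComma.
Variables (B B' D : Category) (H : Functor B D) (K : Functor B' D).

Record isocomma_ob := {
  ic_fst : B;
  ic_snd : B';
  ic_iso : iso (H ic_fst) (K ic_snd)
}.

Record isocomma_hom (s t : isocomma_ob) := {
  ich_fst : hom (ic_fst s) (ic_fst t);
  ich_snd : hom (ic_snd s) (ic_snd t);
  ich_comm : fmap K ich_snd ∘ ic_iso s = ic_iso t ∘ fmap H ich_fst
}.

Lemma isocomma_hom_eq (s t : isocomma_ob) (a b : isocomma_hom s t) :
  ich_fst a = ich_fst b -> ich_snd a = ich_snd b -> a = b.
Proof.
destruct a as [a1 a2 Ha], b as [b1 b2 Hb]; simpl; intros e1 e2; subst b1 b2.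
rewrite (proof_irrelevance _ Ha Hb); reflexivity.
Qed.

Definition isocomma_id (s : isocomma_ob) : isocomma_hom s s.
Proof.
refine {| ich_fst := idm (ic_fst s); ich_snd := idm (ic_snd s) |}.
rewrite !fmap1, compose1m, composem1; reflexivity.
Defined.

Definition isocomma_comp (s t u : isocomma_ob) (b : isocomma_hom t u)
    (a : isocomma_hom s t) : isocomma_hom s u.
Proof.
refine {| ich_fst := ich_fst b ∘ ich_fst a; ich_snd := ich_snd b ∘ ich_snd a |}.
rewrite !fmapM, composeA, (ich_comm a), <- composeA, (ich_comm b), composeA.
reflexivity.
Defined.

Definition isocomma : Category.
Proof.
refine {| ob := isocomma_ob; hom := isocomma_hom;
          idm := isocomma_id; compose := isocomma_comp |}.
- intros; apply isocomma_hom_eq; apply composeA.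
- intros; apply isocomma_hom_eq; apply compose1m.
- intros; apply isocomma_hom_eq; apply composem1.
Defined.

End IsoComma.

Definition isocomma_comparison (A B B' D : Category) (F : Functor A B)
    (G : Functor A B') (H : Functor B D) (K : Functor B' D)
    (θ : nat_square F G H K) : Functor A (isocomma H K).
Proof.
refine (@Build_Functor A (isocomma H K)
  (fun a => {| ic_fst := F a; ic_snd := G a; ic_iso := θ a |} : isocomma H K)
  (fun a a' h => @Build_isocomma_hom _ _ _ H K
     {| ic_fst := F a; ic_snd := G a; ic_iso := θ a |}
     {| ic_fst := F a'; ic_snd := G a'; ic_iso := θ a' |}
     (fmap F h) (fmap G h) (nsq_nat θ h)) _ _).
- intros; apply isocomma_hom_eq; apply fmap1.
- intros; apply isocomma_hom_eq; apply fmapM.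
Defined.

Definition cat_bipullback (A B B' D : Category) (F : Functor A B)
    (G : Functor A B') (H : Functor B D) (K : Functor B' D)
    (θ : nat_square F G H K) : Prop :=
  is_equivalence_functor (isocomma_comparison θ).

(** * Bicategories *)

(* Horizontal composition is functorial in both variables ([hcomp1], [hcompM]);
   1-cells compose in the order [g ⋅ f] = "f, then g". *)
Record Bicategory := {
  bob :> Type;
  bhom : bob -> bob -> Category;
  bid : forall x : bob, bhom x x;
  bcomp : forall x y z : bob, bhom y z -> bhom x y -> bhom x z;
  hcomp : forall (x y z : bob) (g g' : bhom y z) (f f' : bhom x y),
    hom g g' -> hom f f' -> hom (bcomp g f) (bcomp g' f');
  hcomp1 : forall (x y z : bob) (g : bhom y z) (f : bhom x y),
    hcomp (idm g) (idm f) = idm (bcomp g f);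
  hcompM : forall (x y z : bob) (g g' g'' : bhom y z) (f f' f'' : bhom x y)
      (β' : hom g' g'') (β : hom g g') (α' : hom f' f'') (α : hom f f'),
    hcomp (β' ∘ β) (α' ∘ α) = hcomp β' α' ∘ hcomp β α;
  bassoc : forall (x y z t : bob) (h : bhom z t) (g : bhom y z) (f : bhom x y),
    iso (bcomp (bcomp h g) f) (bcomp h (bcomp g f));
  bassoc_nat : forall (x y z t : bob) (h h' : bhom z t) (g g' : bhom y z)
      (f f' : bhom x y) (γ : hom h h') (β : hom g g') (α : hom f f'),
    hcomp γ (hcomp β α) ∘ bassoc h g f = bassoc h' g' f' ∘ hcomp (hcomp γ β) α;
  blunit : forall (x y : bob) (f : bhom x y), iso (bcomp (bid y) f) f;
  blunit_nat : forall (x y : bob) (f f' : bhom x y) (α : hom f f'),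
    α ∘ blunit f = blunit f' ∘ hcomp (idm (bid y)) α;
  brunit : forall (x y : bob) (f : bhom x y), iso (bcomp f (bid x)) f;
  brunit_nat : forall (x y : bob) (f f' : bhom x y) (α : hom f f'),
    α ∘ brunit f = brunit f' ∘ hcomp α (idm (bid x));
  bpentagon : forall (x y z t s : bob) (k : bhom t s) (h : bhom z t)
      (g : bhom y z) (f : bhom x y),
    bassoc k h (bcomp g f) ∘ bassoc (bcomp k h) g f
    = hcomp (idm k) (bassoc h g f)
      ∘ (bassoc k (bcomp h g) f ∘ hcomp (bassoc k h g) (idm f));
  btriangle : forall (x y z : bob) (g : bhom y z) (f : bhom x y),
    hcomp (idm g) (blunit f) ∘ bassoc g (bid y) f = hcomp (brunit g) (idm f)
}.
Arguments bid {_} _.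
Arguments bcomp {_ _ _ _} _ _.
Arguments hcomp {_ _ _ _ _ _ _ _} _ _.
Arguments bassoc {_ _ _ _ _} _ _ _.

Notation "g ⋅ f" := (bcomp g f) (at level 40, left associativity) : cat_scope.

Section BicategoryNotions.
Variable S : Bicategory.

Definition cell_class := forall x y : S, bhom x y -> Prop.

Definition locally_preordered : Prop :=
  forall (x y : S) (f g : bhom x y) (α β : hom f g), α = β.

Definition is_equivalence (x y : S) (f : bhom x y) : Prop :=
  exists g : bhom y x, isomorphic (g ⋅ f) (bid x) /\ isomorphic (f ⋅ g) (bid y).

Definition postcomp (t x y : S) (f : bhom x y) : Functor (bhom t x) (bhom t y).
Proof.
refine (@Build_Functor (bhom t x) (bhom t y)
  (fun u => f ⋅ u) (fun u v α => hcomp (idm f) α) _ _).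
- intros u; apply hcomp1.
- intros u v w β α; rewrite <- hcompM, compose1m; reflexivity.
Defined.

Definition precomp (x y t : S) (e : bhom x y) : Functor (bhom y t) (bhom x t).
Proof.
refine (@Build_Functor (bhom y t) (bhom x t)
  (fun u => u ⋅ e) (fun u v α => hcomp α (idm e)) _ _).
- intros u; apply hcomp1.
- intros u v w β α; rewrite <- hcompM, compose1m; reflexivity.
Defined.

Definition whisker_iso (x y z : S) (g g' : bhom y z) (i : iso g g')
    (f : bhom x y) : iso (g ⋅ f) (g' ⋅ f).
Proof.
refine {| iso_fwd := hcomp (iso_fwd i) (idm f);
          iso_bwd := hcomp (iso_bwd i) (idm f) |}.
- rewrite <- hcompM, iso_bwdK, compose1m; apply hcomp1.
- rewrite <- hcompM, iso_fwdK, compose1m; apply hcomp1.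
Defined.

(* The associativity square  (m ⋅ -) ⋅ e ≅ m ⋅ (- ⋅ e). *)
Definition orth_square (x y a b : S) (e : bhom x y) (m : bhom a b) :
    nat_square (postcomp y m) (precomp a e) (precomp b e) (postcomp x m).
Proof.
refine (@Build_nat_square _ _ _ _ (postcomp y m) (precomp a e)
  (precomp b e) (postcomp x m) (fun w => bassoc m w e) _).
intros w w' σ; apply bassoc_nat.
Defined.

(* The image under S(t,-) of a square  φ : f ⋅ p ≅ g ⋅ q . *)
Definition hom_square_iso (x y z w : S) (f : bhom x z) (g : bhom y z)
    (p : bhom w x) (q : bhom w y) (φ : iso (f ⋅ p) (g ⋅ q)) (t : S)
    (u : bhom t w) : iso (f ⋅ (p ⋅ u)) (g ⋅ (q ⋅ u)) :=
  iso_comp (bassoc g q u)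
    (iso_comp (whisker_iso φ u) (iso_sym (bassoc f p u))).

Lemma bassoc_bwd_nat (x y z t : S) (h h' : bhom z t) (g g' : bhom y z)
    (f f' : bhom x y) (γ : hom h h') (β : hom g g') (α : hom f f') :
  hcomp (hcomp γ β) α ∘ iso_bwd (bassoc h g f)
  = iso_bwd (bassoc h' g' f') ∘ hcomp γ (hcomp β α).
Proof.
rewrite <- (compose1m (hcomp (hcomp γ β) α ∘ _)), <- (iso_bwdK (bassoc h' g' f')).
rewrite composeA, <- (composeA (bassoc h' g' f')), <- bassoc_nat.
rewrite composeA, iso_fwdK, composem1; reflexivity.
Qed.

Definition hom_square (x y z w : S) (f : bhom x z) (g : bhom y z)
    (p : bhom w x) (q : bhom w y) (φ : iso (f ⋅ p) (g ⋅ q)) (t : S) :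
    nat_square (postcomp t p) (postcomp t q) (postcomp t f) (postcomp t g).
Proof.
refine (@Build_nat_square _ _ _ _ (postcomp t p) (postcomp t q)
  (postcomp t f) (postcomp t g) (hom_square_iso φ (t := t)) _).
intros u u' σ; simpl.
rewrite <- composeA, bassoc_nat, !composeA; f_equal.
rewrite <- bassoc_bwd_nat, <- !composeA, <- !hcompM, !hcomp1, !compose1m, !composem1.
reflexivity.
Defined.

Definition bipullback (x y z w : S) (f : bhom x z) (g : bhom y z)
    (p : bhom w x) (q : bhom w y) (φ : iso (f ⋅ p) (g ⋅ q)) : Prop :=
  forall t : S, cat_bipullback (hom_square φ t).

(* The square  f ⋅ p ≅ g ⋅ q  is a bipullback of f and g with projections p, q. *)
Definition is_bipullback (x y z w : S) (f : bhom x z) (g : bhom y z)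
    (p : bhom w x) (q : bhom w y) : Prop :=
  exists φ : iso (f ⋅ p) (g ⋅ q), bipullback φ.

Record bicat_class (K : cell_class) : Prop := {
  bcl_equiv : forall (x y : S) (f : bhom x y), is_equivalence f -> K x y f;
  bcl_comp : forall (x y z : S) (g : bhom y z) (f : bhom x y),
    K y z g -> K x y f -> K x z (g ⋅ f);
  bcl_iso : forall (x y : S) (f g : bhom x y),
    isomorphic f g -> K x y f -> K x y g
}.

Record bicat_factorization_system (U L : cell_class) : Prop := {
  bfs_left : bicat_class U;
  bfs_right : bicat_class L;
  bfs_orth : forall (x y a b : S) (e : bhom x y) (m : bhom a b),
    U x y e -> L a b m -> cat_bipullback (orth_square e m);
  bfs_fact : forall (x y : S) (f : bhom x y),
    exists (i : S) (e : bhom x i) (m : bhom i y),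
      U x i e /\ L i y m /\ isomorphic f (m ⋅ e)
}.

Definition has_bipullbacks_in (K : cell_class) : Prop :=
  forall (x y z : S) (f : bhom x z) (g : bhom y z), K x z f -> K y z g ->
    (exists (w : S) (p : bhom w x) (q : bhom w y), is_bipullback f g p q) /\
    (forall (w : S) (p : bhom w x) (q : bhom w y),
       is_bipullback f g p q -> K w x p /\ K w y q).

Definition fake_square (U L : cell_class) (X Y Z : S) (a : bhom X Z)
    (x : bhom Y Z) (W : S) (b : bhom W Y) (y : bhom W X) : Prop :=
  U W Y b /\ L W X y /\ inhabited (hom (x ⋅ b) (a ⋅ y)).

Definition fpr_V2 (U L : cell_class) : Prop :=
  forall (X Y Z : S) (a : bhom X Z) (x : bhom Y Z), U X Z a -> L Y Z x ->
    (exists (W : S) (b : bhom W Y) (y : bhom W X), fake_square U L a x b y) /\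
    (forall (W W' : S) (b : bhom W Y) (y : bhom W X)
       (b' : bhom W' Y) (y' : bhom W' X),
       fake_square U L a x b y -> fake_square U L a x b' y' ->
       exists h : bhom W W', is_equivalence h /\
         isomorphic (b' ⋅ h) b /\ isomorphic (y' ⋅ h) y).

Definition fpr_V3 (U L : cell_class) : Prop :=
  forall (X Y Z A B C I J : S)
    (x : bhom X Y) (y : bhom A B) (r : bhom X A) (s : bhom Y B) (t : bhom Z C)
    (a : bhom Y Z) (b : bhom B C)
    (c : bhom X I) (v : bhom I Z) (d : bhom A J) (w : bhom J C),
    L X Y x -> L A B y -> L X A r -> L Y B s -> L Z C t ->
    U Y Z a -> U B C b ->
    is_bipullback s y x r -> inhabited (hom (t ⋅ a) (b ⋅ s)) ->
    U X I c -> L I Z v -> isomorphic (a ⋅ x) (v ⋅ c) ->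
    U A J d -> L J C w -> isomorphic (b ⋅ y) (w ⋅ d) ->
    exists q : bhom I J,
      L I J q /\ inhabited (hom (q ⋅ c) (d ⋅ r)) /\ is_bipullback t w v q.

Definition fpr_V4 (U L : cell_class) : Prop :=
  forall (X Y Z D E F K I : S)
    (x : bhom X Y) (u : bhom D E)
    (h : bhom E F) (a : bhom Y Z) (e : bhom D X) (f : bhom E Y) (g : bhom F Z)
    (k : bhom D K) (p : bhom K F) (c : bhom X I) (v : bhom I Z),
    L X Y x -> L D E u ->
    U E F h -> U Y Z a -> U D X e -> U E Y f -> U F Z g ->
    inhabited (hom (x ⋅ e) (f ⋅ u)) -> is_bipullback g a h f ->
    U D K k -> L K F p -> isomorphic (h ⋅ u) (p ⋅ k) ->
    U X I c -> L I Z v -> isomorphic (a ⋅ x) (v ⋅ c) ->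
    exists j : bhom K I,
      U K I j /\ is_bipullback j c k e /\ inhabited (hom (v ⋅ j) (g ⋅ p)).

Record fake_pullback_ready (U L : cell_class) : Prop := {
  fpr_preordered : locally_preordered;
  fpr_fs : bicat_factorization_system U L;
  fpr_V1_left : has_bipullbacks_in U;
  fpr_V1_right : has_bipullbacks_in L;
  fpr_prop_V2 : fpr_V2 U L;
  fpr_prop_V3 : fpr_V3 U L;
  fpr_prop_V4 : fpr_V4 U L
}.

End BicategoryNotions.

(** * Suitable factorization systems *)

Definition is_pullback (C : Category) (x y z w : C) (f : hom x z) (g : hom y z)
    (p : hom w x) (q : hom w y) : Prop :=
  f ∘ p = g ∘ q /\
  forall (t : C) (a : hom t x) (b : hom t y), f ∘ a = g ∘ b ->
    exists! k : hom t w, p ∘ k = a /\ q ∘ k = b.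

Definition is_pushout (C : Category) (x y z w : C) (f : hom z x) (g : hom z y)
    (i : hom x w) (j : hom y w) : Prop :=
  i ∘ f = j ∘ g /\
  forall (t : C) (a : hom x t) (b : hom y t), a ∘ f = b ∘ g ->
    exists! k : hom w t, k ∘ i = a /\ k ∘ j = b.

Definition mor_class (C : Category) := forall x y : C, hom x y -> Prop.

Record wide_class (C : Category) (K : mor_class C) : Prop := {
  wcl_iso : forall (x y : C) (f : hom x y), is_iso f -> K x y f;
  wcl_comp : forall (x y z : C) (g : hom y z) (f : hom x y),
    K y z g -> K x y f -> K x z (g ∘ f)
}.

Record factorization_system (C : Category) (E M : mor_class C) : Prop := {
  fs_left : wide_class E;
  fs_right : wide_class M;
  fs_orth : forall (x y a b : C) (e : hom x y) (m : hom a b)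
      (u : hom x a) (v : hom y b),
    E x y e -> M a b m -> m ∘ u = v ∘ e ->
    exists! w : hom y a, w ∘ e = u /\ m ∘ w = v;
  fs_fact : forall (x y : C) (f : hom x y),
    exists (i : C) (e : hom x i) (m : hom i y),
      E x i e /\ M i y m /\ f = m ∘ e
}.

Record suitable (C : Category) (E M : mor_class C) : Prop := {
  sfs_fs : factorization_system E M;
  sfs_1 : forall (x y z : C) (m : hom x z) (f : hom y z), M x z m ->
    exists (w : C) (p : hom w x) (q : hom w y), is_pullback m f p q;
  sfs_2 : forall (x y z : C) (e : hom z x) (f : hom z y), E z x e ->
    exists (w : C) (i : hom x w) (j : hom y w), is_pushout e f i j;
  sfs_3 : forall (x y z w : C) (m : hom x z) (e : hom y z)
      (p : hom w x) (q : hom w y),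
    M x z m -> E y z e -> is_pullback m e p q -> E w x p;
  sfs_4 : forall (x y z w : C) (e : hom z x) (m : hom z y)
      (i : hom x w) (j : hom y w),
    E z x e -> M z y m -> is_pushout e m i j -> M x w i;
  sfs_5 : forall (D A B X : C) (n : hom D B) (m : hom A X)
      (e : hom D A) (d : hom B X),
    M D B n -> M A X m -> E D A e -> E B X d -> d ∘ n = m ∘ e ->
    (is_pullback d m n e <-> is_pushout n e d m)
}.

Section FactorizationFacts.
Variables (C : Category) (E M : mor_class C).
Hypothesis fs : factorization_system E M.

Lemma right_class_pullback (x y z w : C) (m : hom x z) (g : hom y z)
    (p : hom w x) (q : hom w y) :
  M m -> is_pullback m g p q -> M q.
Proof.
intros Mm [Hc Hu].
destruct (fs_fact fs q) as (i & e & n & Ee & Mn & Hq).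
assert (Hsq : m ∘ p = (g ∘ n) ∘ e) by (rewrite composeA, <- Hq; exact Hc).
destruct (fs_orth fs Ee Mm Hsq) as (k & [Hk1 Hk2] & _).
destruct (Hu _ _ _ Hk2) as (s & [Hs1 Hs2] & _).
assert (se : s ∘ e = idm w).
{ destruct (Hu _ _ _ Hc) as (k0 & _ & U0).
  transitivity k0; [symmetry |]; apply U0; split.
  - rewrite <- composeA, Hs1; exact Hk1.
  - rewrite <- composeA, Hs2; symmetry; exact Hq.
  - apply composem1.
  - apply composem1. }
assert (es : e ∘ s = idm i).
{ destruct (fs_orth fs Ee Mn (eq_refl (n ∘ e))) as (k0 & _ & U0).
  transitivity k0; [symmetry |]; apply U0; split.
  - rewrite composeA, se; apply composem1.
  - rewrite <- composeA, <- Hq; exact Hs2.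
  - apply compose1m.
  - apply composem1. }
rewrite Hq; apply (wcl_comp (fs_right fs) Mn).
apply (wcl_iso (fs_right fs)); exists s; split; assumption.
Qed.

Lemma left_class_pushout (x y z w : C) (e : hom z x) (g : hom z y)
    (i : hom x w) (j : hom y w) :
  E e -> is_pushout e g i j -> E j.
Proof.
intros Ee [Hc Hu].
destruct (fs_fact fs j) as (k & d & n & Ed & Mn & Hj).
assert (Hsq : n ∘ (d ∘ g) = i ∘ e)
  by (rewrite <- composeA, <- Hj; symmetry; exact Hc).
destruct (fs_orth fs Ee Mn Hsq) as (l & [Hl1 Hl2] & _).
destruct (Hu _ _ _ Hl1) as (s & [Hs1 Hs2] & _).
assert (ns : n ∘ s = idm w).
{ destruct (Hu _ _ _ Hc) as (k0 & _ & U0).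
  transitivity k0; [symmetry |]; apply U0; split.
  - rewrite composeA, Hs1; exact Hl2.
  - rewrite composeA, Hs2; symmetry; exact Hj.
  - apply compose1m.
  - apply compose1m. }
assert (sn : s ∘ n = idm k).
{ destruct (fs_orth fs Ed Mn (eq_refl (n ∘ d))) as (k0 & _ & U0).
  transitivity k0; [symmetry |]; apply U0; split.
  - rewrite composeA, <- Hj; exact Hs2.
  - rewrite <- composeA, ns; apply compose1m.
  - apply compose1m.
  - apply composem1. }
rewrite Hj; refine (wcl_comp (fs_left fs) _ Ed).
apply (wcl_iso (fs_left fs)); exists s; split; assumption.
Qed.

Lemma is_iso_idm (x : C) : is_iso (idm x).
Proof. exists (idm x); split; apply compose1m. Qed.

Lemma left_class_id (x : C) : E (idm x).
Proof. apply (wcl_iso (fs_left fs)), is_iso_idm. Qed.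

Lemma right_class_id (x : C) : M (idm x).
Proof. apply (wcl_iso (fs_right fs)), is_iso_idm. Qed.

End FactorizationFacts.

(** * The bicategory of spans *)

Record pullback_cone (C : Category) (x y z : C) (f : hom x z) (g : hom y z) := {
  pb_ob : C;
  pb_fst : hom pb_ob x;
  pb_snd : hom pb_ob y;
  pb_is_pullback : is_pullback f g pb_fst pb_snd
}.

(* Composition of spans depends on a choice of pullbacks; only cospans with
   one leg in M and the other in E occur. *)
Definition pullback_choice (C : Category) (E M : mor_class C) :=
  forall (x y z : C) (m : hom x z) (e : hom y z),
    M x z m -> E y z e -> pullback_cone m e.

Lemma pullback_choice_inhabited (C : Category) (E M : mor_class C) :
  suitable E M -> inhabited (pullback_choice E M).
Proof.
intros HS; constructor; intros x y z m e Mm _.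
destruct (constructive_indefinite_description _ (sfs_1 HS e Mm)) as [w Hw].
destruct (constructive_indefinite_description _ Hw) as [p Hp].
destruct (constructive_indefinite_description _ Hp) as [q Hq].
exact {| pb_is_pullback := Hq |}.
Qed.

Section PullbackLift.
Variables (C : Category) (x y z : C) (f : hom x z) (g : hom y z).
Variable P : pullback_cone f g.

Lemma pb_comm : f ∘ pb_fst P = g ∘ pb_snd P.
Proof. exact (proj1 (pb_is_pullback P)). Qed.

Definition pb_lift (t : C) (a : hom t x) (b : hom t y) (H : f ∘ a = g ∘ b) :
    hom t (pb_ob P) :=
  proj1_sig (constructive_indefinite_description _
    (proj2 (pb_is_pullback P) t a b H)).

Lemma pb_lift_fst (t : C) (a : hom t x) (b : hom t y) (H : f ∘ a = g ∘ b) :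
  pb_fst P ∘ pb_lift H = a.
Proof.
unfold pb_lift; destruct (constructive_indefinite_description _ _) as [k [[H1 H2] U]].
exact H1.
Qed.

Lemma pb_lift_snd (t : C) (a : hom t x) (b : hom t y) (H : f ∘ a = g ∘ b) :
  pb_snd P ∘ pb_lift H = b.
Proof.
unfold pb_lift; destruct (constructive_indefinite_description _ _) as [k [[H1 H2] U]].
exact H2.
Qed.

End PullbackLift.

Section Span.
Variables (C : Category) (E M : mor_class C).

Record span (U W : C) := {
  apex : C;
  sleft : hom apex U;
  sright : hom apex W;
  sleft_E : E sleft;
  sright_M : M sright
}.

Record span_mor (U W : C) (r s : span U W) := {
  smor : hom (apex r) (apex s);
  smor_left : sleft s ∘ smor = sleft r;
  smor_right : sright s ∘ smor = sright r
}.

Lemma span_mor_eq (U W : C) (r s : span U W) (a b : span_mor r s) :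
  smor a = smor b -> a = b.
Proof.
destruct a as [a Ha Ha'], b as [b Hb Hb']; simpl; intros e; subst b.
rewrite (proof_irrelevance _ Ha Hb), (proof_irrelevance _ Ha' Hb'); reflexivity.
Qed.

Definition span_mor_id (U W : C) (r : span U W) : span_mor r r :=
  {| smor := idm (apex r) : hom (apex r) (apex r);
     smor_left := composem1 (sleft r); smor_right := composem1 (sright r) |}.

Definition span_mor_comp (U W : C) (r s t : span U W) (b : span_mor s t)
    (a : span_mor r s) : span_mor r t.
Proof.
refine {| smor := smor b ∘ smor a |}.
- rewrite <- composeA, smor_left; apply smor_left.
- rewrite <- composeA, smor_right; apply smor_right.
Defined.

Definition span_cat (U W : C) : Category.
Proof.
refine {| ob := span U W; hom := @span_mor U W;
          idm := @span_mor_id U W; compose := @span_mor_comp U W |}.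
- intros; apply span_mor_eq, composeA.
- intros; apply span_mor_eq, compose1m.
- intros; apply span_mor_eq, composem1.
Defined.

Hypothesis HS : suitable E M.
Variable pb : pullback_choice E M.

(* The legs of a span are jointly monic: a span is the pullback of the pushout
   of its legs. *)
Lemma span_mor_unique (U W : C) (r s : span U W) (a b : span_mor r s) : a = b.
Proof.
apply span_mor_eq.
destruct (sfs_2 HS (sright s) (sleft_E s)) as (w & i & j & Hpo).
assert (Mi := sfs_4 HS (sleft_E s) (sright_M s) Hpo).
assert (Ej := left_class_pushout (sfs_fs HS) (sleft_E s) Hpo).
assert (Hpo' : is_pushout (sright s) (sleft s) j i).
{ destruct Hpo as [Hc Hu]; split; [symmetry; exact Hc |].
  intros t u v Huv; destruct (Hu t v u (eq_sym Huv)) as (k & [K1 K2] & Uk).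
  exists k; split; [split; assumption |].
  intros k' [L1 L2]; apply Uk; split; assumption. }
assert (Hpb : is_pullback j i (sright s) (sleft s)).
{ apply (sfs_5 HS (sright_M s) Mi (sleft_E s) Ej); [exact (proj1 Hpo') | exact Hpo']. }
destruct Hpb as [Hc Hu].
assert (H0 : j ∘ sright r = i ∘ sleft r).
{ rewrite <- (smor_right a), <- (smor_left a), <- !composeA, Hc; reflexivity. }
destruct (Hu _ _ _ H0) as (k & _ & Uk).
transitivity k; [symmetry |]; apply Uk; split;
  first [apply smor_right | apply smor_left].
Qed.

Definition span_id (U : C) : span U U :=
  {| sleft := idm U; sright := idm U;
     sleft_E := left_class_id (sfs_fs HS) U;
     sright_M := right_class_id (sfs_fs HS) U |}.

Definition span_pb (U V W : C) (s : span V W) (r : span U V) :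
    pullback_cone (sright r) (sleft s) :=
  pb (sright_M r) (sleft_E s).

Definition span_comp (U V W : C) (s : span V W) (r : span U V) : span U W.
Proof.
refine {| sleft := sleft r ∘ pb_fst (span_pb s r);
          sright := sright s ∘ pb_snd (span_pb s r) |}.
- apply (wcl_comp (fs_left (sfs_fs HS)) (sleft_E r)).
  exact (sfs_3 HS (sright_M r) (sleft_E s) (pb_is_pullback (span_pb s r))).
- apply (wcl_comp (fs_right (sfs_fs HS)) (sright_M s)).
  exact (right_class_pullback (sfs_fs HS) (sright_M r) (pb_is_pullback (span_pb s r))).
Defined.

(* A 2-cell into a composite is a compatible pair of morphisms of C. *)
Definition span_comp_lift (U V W : C) (s : span V W) (r : span U V)
    (t : span U W) (a : hom (apex t) (apex r)) (b : hom (apex t) (apex s))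
    (H : sright r ∘ a = sleft s ∘ b)
    (Ha : sleft r ∘ a = sleft t) (Hb : sright s ∘ b = sright t) :
    span_mor t (span_comp s r).
Proof.
refine (@Build_span_mor U W t (span_comp s r) (pb_lift (span_pb s r) H) _ _); simpl.
- rewrite composeA, pb_lift_fst; exact Ha.
- rewrite composeA, pb_lift_snd; exact Hb.
Defined.

Definition span_hcomp (U V W : C) (s s' : span V W) (r r' : span U V)
    (β : span_mor s s') (α : span_mor r r') :
    span_mor (span_comp s r) (span_comp s' r').
Proof.
refine (@span_comp_lift U V W s' r' (span_comp s r)
  (smor α ∘ pb_fst (span_pb s r)) (smor β ∘ pb_snd (span_pb s r)) _ _ _); simpl.
- rewrite <- !composeA, smor_right, smor_left; apply pb_comm.
- rewrite <- composeA, smor_left; reflexivity.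
- rewrite <- composeA, smor_right; reflexivity.
Defined.

Definition span_iso (U W : C) (r s : span U W) (a : span_mor r s)
    (b : span_mor s r) : @iso (span_cat U W) r s :=
  {| iso_fwd := a : @hom (span_cat U W) r s; iso_bwd := b;
     iso_bwdK := span_mor_unique _ _; iso_fwdK := span_mor_unique _ _ |}.

Definition span_assoc_fwd (U V W X : C) (t : span W X) (s : span V W)
    (r : span U V) :
    span_mor (span_comp (span_comp t s) r) (span_comp t (span_comp s r)).
Proof.
pose (P := span_pb (span_comp t s) r).
pose (Q := span_pb t s).
assert (H : sright r ∘ pb_fst P = sleft s ∘ (pb_fst Q ∘ pb_snd P)).
{ rewrite <- composeA; exact (pb_comm P). }
refine (@span_comp_lift _ _ _ t (span_comp s r) (span_comp (span_comp t s) r)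
  (pb_lift (span_pb s r) H) (pb_snd Q ∘ pb_snd P) _ _ _); simpl.
- rewrite composeA, pb_lift_snd, <- !composeA; f_equal; exact (pb_comm Q).
- rewrite composeA, pb_lift_fst; reflexivity.
- rewrite composeA; reflexivity.
Defined.

Definition span_assoc_bwd (U V W X : C) (t : span W X) (s : span V W)
    (r : span U V) :
    span_mor (span_comp t (span_comp s r)) (span_comp (span_comp t s) r).
Proof.
pose (P := span_pb t (span_comp s r)).
pose (Q := span_pb s r).
assert (H : sright s ∘ (pb_snd Q ∘ pb_fst P) = sleft t ∘ pb_snd P).
{ rewrite <- composeA; exact (pb_comm P). }
refine (@span_comp_lift _ _ _ (span_comp t s) r (span_comp t (span_comp s r))
  (pb_fst Q ∘ pb_fst P) (pb_lift (span_pb t s) H) _ _ _); simpl.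
- rewrite composeA, pb_lift_fst, <- !composeA; f_equal; exact (pb_comm Q).
- rewrite composeA; reflexivity.
- rewrite composeA, pb_lift_snd; reflexivity.
Defined.

Definition span_lunit_fwd (U W : C) (r : span U W) :
    span_mor (span_comp (span_id W) r) r.
Proof.
refine (@Build_span_mor U W (span_comp (span_id W) r) r
  (pb_fst (span_pb (span_id W) r)) _ _); simpl.
- reflexivity.
- exact (pb_comm (span_pb (span_id W) r)).
Defined.

Definition span_lunit_bwd (U W : C) (r : span U W) :
    span_mor r (span_comp (span_id W) r).
Proof.
refine (@span_comp_lift _ _ _ (span_id W) r r (idm _) (sright r) _ _ _); simpl.
- rewrite composem1, compose1m; reflexivity.
- apply composem1.
- apply compose1m.
Defined.

Definition span_runit_fwd (U W : C) (r : span U W) :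
    span_mor (span_comp r (span_id U)) r.
Proof.
refine (@Build_span_mor U W (span_comp r (span_id U)) r
  (pb_snd (span_pb r (span_id U))) _ _); simpl.
- symmetry; exact (pb_comm (span_pb r (span_id U))).
- reflexivity.
Defined.

Definition span_runit_bwd (U W : C) (r : span U W) :
    span_mor r (span_comp r (span_id U)).
Proof.
refine (@span_comp_lift _ _ _ r (span_id U) r (sleft r) (idm _) _ _ _); simpl.
- rewrite composem1, compose1m; reflexivity.
- apply compose1m.
- apply composem1.
Defined.

Definition Spn : Bicategory.
Proof.
refine (@Build_Bicategory C span_cat span_id span_comp span_hcomp _ _
  (fun U V W X t s r => span_iso (span_assoc_fwd t s r) (span_assoc_bwd t s r)) _
  (fun U W r => span_iso (span_lunit_fwd r) (span_lunit_bwd r)) _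
  (fun U W r => span_iso (span_runit_fwd r) (span_runit_bwd r)) _ _ _);
  intros; apply span_mor_unique.
Defined.

Definition lower_star (X Y : C) (m : hom X Y) (Mm : M m) : @bhom Spn X Y :=
  {| sleft := idm X; sright := m;
     sleft_E := left_class_id (sfs_fs HS) X; sright_M := Mm |}.

Definition upper_star (X Y : C) (e : hom X Y) (Ee : E e) : @bhom Spn Y X :=
  {| sleft := e; sright := idm X;
     sleft_E := Ee; sright_M := right_class_id (sfs_fs HS) X |}.

Definition M_lower_star : cell_class Spn := fun X Y f =>
  exists (m : @hom C X Y) (Mm : M m), isomorphic f (lower_star Mm).

Definition E_upper_star : cell_class Spn := fun Y X f =>
  exists (e : @hom C X Y) (Ee : E e), isomorphic f (upper_star Ee).

End Span.
Arguments M_lower_star {C E M} HS pb _ _ _.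
Arguments E_upper_star {C E M} HS pb _ _ _.

(* Main.v *)
(** Since Spn(E, M) is locally preordered, bipullbacks and orthogonality reduce to
    statements about the hom-preorders. In these terms: a 2-cell from m_* d^* to
    e^* n_* exists iff n d = e m in C, and such a square invertible means that it
    is a pullback; bipullback squares of the m_* are the pullback squares of C, and,
    on describing spans by the cospans that (SFS5) associates with them, bipullback
    squares of the e^* are the pushout squares of C. So V2 is uniqueness of
    factorizations, and V3 is pasting of pullbacks. For V4, factorize the
    composite g v = n l, push l out along c to get Q: pasting makes the map from
    Q to the codomain of u a pushout of n, hence a member of M, whence the
    comparison of Q with the domain of u is both in M and in E, so the square on
    l and c is itself a pushout. *)

From Stdlib Require Import Setoid Morphisms.
Require Import Defs.

Set Implicit Arguments.
Unset Strict Implicit.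
Unset Printing Implicit Defensive.

Notation "f ≅ g" := (isomorphic f g) (at level 70) : cat_scope.

Definition has_hom (C : Category) (x y : C) : Prop := inhabited (hom x y).
Notation "f ≼ g" := (has_hom f g) (at level 70) : cat_scope.

(** * Isomorphisms, pullbacks and pushouts *)

Definition opposite (C : Category) : Category.
Proof.
refine {| ob := ob C; hom := fun x y => @hom C y x; idm := @idm C;
          compose := fun x y z g f => f ∘ g |}.
- intros; symmetry; apply composeA.
- intros; apply composem1.
- intros; apply compose1m.
Defined.

Section CategoryFacts.
Variable C : Category.

Lemma is_iso_comp (x y z : C) (g : hom y z) (f : hom x y) :
  is_iso g -> is_iso f -> is_iso (g ∘ f).
Proof.
intros (g' & G1 & G2) (f' & F1 & F2); exists (f' ∘ g'); split.
- exact (compose_cancel G1 F1).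
- exact (compose_cancel F2 G2).
Qed.

Lemma is_iso_bi_inverse (x y : C) (f : hom x y) (g g' : hom y x) :
  g ∘ f = idm x -> f ∘ g' = idm y -> is_iso f.
Proof.
intros Hg Hg'; exists g; split; [exact Hg |].
assert (H : g = g') by (rewrite <- (composem1 g), <- Hg', <- composeA, Hg; apply compose1m).
rewrite H; exact Hg'.
Qed.

Lemma is_iso_cancel_left (x y z : C) (g : hom y z) (f : hom x y) :
  is_iso g -> is_iso (g ∘ f) -> is_iso f.
Proof.
intros (g' & G1 & G2) (h & H1 & H2).
apply (@is_iso_bi_inverse _ _ f (h ∘ g) (h ∘ g)).
- rewrite composeA; exact H1.
- rewrite <- (compose1m (f ∘ (h ∘ g))), <- G1, composeA.
  rewrite <- (composeA g f), <- (composeA (g ∘ f)), H2, compose1m; reflexivity.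
Qed.

Lemma is_iso_cancel_right (x y z : C) (g : hom y z) (f : hom x y) :
  is_iso f -> is_iso (g ∘ f) -> is_iso g.
Proof.
intros (f' & F1 & F2) (h & H1 & H2).
apply (@is_iso_bi_inverse _ _ g (f ∘ h) (f ∘ h)).
- rewrite <- (composem1 (f ∘ h ∘ g)), <- F2, <- (composeA (f ∘ h ∘ g)).
  rewrite !composeA, <- (composeA g f), <- (composeA h), H1, compose1m; reflexivity.
- rewrite <- composeA; exact H2.
Qed.

(** [h ∘ g] supplies a left inverse of [g] and [g ∘ f] a right inverse. This is how
    [equivalence_legs] inverts maps about which only composites are known. *)
Lemma is_iso_middle (x y z t : C) (h : hom z t) (g : hom y z) (f : hom x y) :
  is_iso (h ∘ g) -> is_iso (g ∘ f) -> is_iso g.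
Proof.
intros (a & A1 & _) (b & _ & B2).
apply (@is_iso_bi_inverse _ _ g (a ∘ h) (f ∘ b)).
- rewrite composeA; exact A1.
- rewrite <- composeA; exact B2.
Qed.

Lemma pullback_ext (x y z w : C) (f : hom x z) (g : hom y z)
    (p : hom w x) (q : hom w y) :
  is_pullback f g p q -> forall (t : C) (k l : hom t w),
  p ∘ k = p ∘ l -> q ∘ k = q ∘ l -> k = l.
Proof.
intros [Hc Hu] t k l Hp Hq.
assert (H : f ∘ (p ∘ l) = g ∘ (q ∘ l)) by (rewrite <- !composeA, Hc; reflexivity).
destruct (Hu _ _ _ H) as (s & _ & U).
transitivity s; [symmetry |]; apply U; split; auto.
Qed.

Lemma pullback_lift (x y z w : C) (f : hom x z) (g : hom y z)
    (p : hom w x) (q : hom w y) :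
  is_pullback f g p q -> forall (t : C) (a : hom t x) (b : hom t y),
  f ∘ a = g ∘ b -> exists k : hom t w, p ∘ k = a /\ q ∘ k = b.
Proof. intros [_ Hu] t a b H; destruct (Hu _ _ _ H) as (k & K & _); eauto. Qed.

Lemma pullback_intro (x y z w : C) (f : hom x z) (g : hom y z)
    (p : hom w x) (q : hom w y) :
  f ∘ p = g ∘ q ->
  (forall (t : C) (k l : hom t w), p ∘ k = p ∘ l -> q ∘ k = q ∘ l -> k = l) ->
  (forall (t : C) (a : hom t x) (b : hom t y), f ∘ a = g ∘ b ->
     exists k : hom t w, p ∘ k = a /\ q ∘ k = b) ->
  is_pullback f g p q.
Proof.
intros Hc Hm Hl; split; [exact Hc |]; intros t a b H.
destruct (Hl _ _ _ H) as (k & K1 & K2).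
exists k; split; [auto |]; intros l [L1 L2]; apply Hm; congruence.
Qed.

Lemma pullback_sym (x y z w : C) (f : hom x z) (g : hom y z)
    (p : hom w x) (q : hom w y) :
  is_pullback f g p q -> is_pullback g f q p.
Proof.
intros H; apply pullback_intro; [symmetry; apply H | |].
- intros t k l ? ?; apply (pullback_ext H); assumption.
- intros t a b Hab; destruct (pullback_lift H (eq_sym Hab)) as (k & ? & ?); eauto.
Qed.

Lemma pullback_paste (x x' y z w w' : C) (f : hom x z) (g : hom y z)
    (p : hom w x) (q : hom w y) (h : hom x' x) (p' : hom w' x') (q' : hom w' w) :
  is_pullback f g p q -> is_pullback h p p' q' ->
  is_pullback (f ∘ h) g p' (q ∘ q').
Proof.
intros H H'; apply pullback_intro.
- rewrite composeA, (proj1 H'), <- !composeA, (proj1 H); reflexivity.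
- intros t k l H1 H2; rewrite !composeA in H2.
  apply (pullback_ext H'); [exact H1 |].
  apply (pullback_ext H); [| exact H2].
  rewrite <- !composeA, <- (proj1 H'), !composeA, H1; reflexivity.
- intros t a b Hab; rewrite composeA in Hab.
  destruct (pullback_lift H Hab) as (k & K1 & K2).
  destruct (pullback_lift H' (eq_sym K1)) as (l & L1 & L2).
  exists l; split; [exact L1 |]; rewrite composeA, L2; exact K2.
Qed.

(** The last hypothesis is separate because the two pullbacks only give [h ∘ p' = p ∘ q'] after
    composing with [f]. *)
Lemma pullback_cancel (x x' y z w w' : C) (f : hom x z) (g : hom y z)
    (p : hom w x) (q : hom w y) (h : hom x' x) (p' : hom w' x') (q' : hom w' w) :
  is_pullback f g p q -> is_pullback (f ∘ h) g p' (q ∘ q') ->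
  h ∘ p' = p ∘ q' -> is_pullback h p p' q'.
Proof.
intros H H' Hc; apply pullback_intro; [exact Hc | |].
- intros t k l H1 H2; apply (pullback_ext H'); [exact H1 |].
  rewrite !composeA, H2; reflexivity.
- intros t a b Hab.
  assert (Hab' : f ∘ h ∘ a = g ∘ (q ∘ b))
    by (rewrite composeA, Hab, <- !composeA, (proj1 H); reflexivity).
  destruct (pullback_lift H' Hab') as (k & K1 & K2).
  exists k; split; [exact K1 |].
  apply (pullback_ext H).
  + rewrite <- composeA, <- Hc, composeA, K1; exact Hab.
  + rewrite <- composeA; exact K2.
Qed.

Lemma pullback_comp_iso (x y z w w' : C) (f : hom x z) (g : hom y z)
    (p : hom w x) (q : hom w y) (k : hom w' w) :
  is_iso k -> is_pullback f g p q -> is_pullback f g (p ∘ k) (q ∘ k).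
Proof.
intros (k' & K1 & K2) H; apply pullback_intro.
- rewrite <- !composeA, (proj1 H); reflexivity.
- intros t a b H1 H2; rewrite !composeA in H1, H2.
  rewrite <- (compose1m a), <- (compose1m b), <- K1, !composeA.
  f_equal; apply (pullback_ext H); assumption.
- intros t a b Hab; destruct (pullback_lift H Hab) as (l & L1 & L2).
  exists (k' ∘ l).
  rewrite !composeA, <- !(composeA k k'), K2, compose1m; auto.
Qed.

Lemma pullback_unique (x y z w w' : C) (f : hom x z) (g : hom y z)
    (p : hom w x) (q : hom w y) (p' : hom w' x) (q' : hom w' y) :
  is_pullback f g p q -> is_pullback f g p' q' ->
  exists k : hom w' w, is_iso k /\ p ∘ k = p' /\ q ∘ k = q'.
Proof.
intros H H'.
destruct (pullback_lift H (proj1 H')) as (k & K1 & K2).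
destruct (pullback_lift H' (proj1 H)) as (l & L1 & L2).
exists k; split; [| auto]; exists l; split.
- apply (pullback_ext H'); rewrite <- composeA, composem1; congruence.
- apply (pullback_ext H); rewrite <- composeA, composem1; congruence.
Qed.

End CategoryFacts.

(* [is_pushout] in C is convertible to [is_pullback] in the opposite category,
   so every fact about pullbacks dualizes. *)
Section PushoutFacts.
Variable C : Category.

Lemma pushout_ext (x y z w : C) (f : hom z x) (g : hom z y)
    (i : hom x w) (j : hom y w) :
  is_pushout f g i j -> forall (t : C) (k l : hom w t),
  k ∘ i = l ∘ i -> k ∘ j = l ∘ j -> k = l.
Proof. exact (@pullback_ext (opposite C) x y z w f g i j). Qed.

Lemma pushout_desc (x y z w : C) (f : hom z x) (g : hom z y)
    (i : hom x w) (j : hom y w) :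
  is_pushout f g i j -> forall (t : C) (a : hom x t) (b : hom y t),
  a ∘ f = b ∘ g -> exists k : hom w t, k ∘ i = a /\ k ∘ j = b.
Proof. exact (@pullback_lift (opposite C) x y z w f g i j). Qed.

Lemma pushout_sym (x y z w : C) (f : hom z x) (g : hom z y)
    (i : hom x w) (j : hom y w) :
  is_pushout f g i j -> is_pushout g f j i.
Proof. exact (@pullback_sym (opposite C) x y z w f g i j). Qed.

Lemma pushout_paste (x x' y z w w' : C) (f : hom z x) (g : hom z y)
    (i : hom x w) (j : hom y w) (h : hom x x') (i' : hom x' w') (j' : hom w w') :
  is_pushout f g i j -> is_pushout h i i' j' ->
  is_pushout (h ∘ f) g i' (j' ∘ j).
Proof. exact (@pullback_paste (opposite C) x x' y z w w' f g i j h i' j'). Qed.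

Lemma pushout_cancel (x x' y z w w' : C) (f : hom z x) (g : hom z y)
    (i : hom x w) (j : hom y w) (h : hom x x') (i' : hom x' w') (j' : hom w w') :
  is_pushout f g i j -> is_pushout (h ∘ f) g i' (j' ∘ j) ->
  i' ∘ h = j' ∘ i -> is_pushout h i i' j'.
Proof. exact (@pullback_cancel (opposite C) x x' y z w w' f g i j h i' j'). Qed.

Lemma is_iso_opposite (x y : C) (f : hom x y) :
  is_iso f -> @is_iso (opposite C) y x f.
Proof. intros (g & G1 & G2); exists g; split; assumption. Qed.

Lemma pushout_comp_iso (x y z w w' : C) (f : hom z x) (g : hom z y)
    (i : hom x w) (j : hom y w) (k : hom w w') :
  is_iso k -> is_pushout f g i j -> is_pushout f g (k ∘ i) (k ∘ j).
Proof.
intros K; exact (@pullback_comp_iso (opposite C) x y z w w' f g i j k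
  (is_iso_opposite K)).
Qed.

(** This replaces one foot of the span by an isomorphic object. V4 uses it to pass from the
    intermediate object of its own factorization to the prescribed one. *)
Lemma pushout_move_iso (x x' y z w : C) (f : hom z x) (g : hom z y)
    (i : hom x' w) (j : hom y w) (k : hom x x') :
  is_iso k -> is_pushout f g (i ∘ k) j -> is_pushout (k ∘ f) g i j.
Proof.
intros (k' & K1 & K2) [Hc Hu]; split; [rewrite <- composeA; exact Hc |].
intros t a b Hab; rewrite <- composeA in Hab.
assert (K : forall (t : C) (l m : hom x' t), l ∘ k = m ∘ k -> l = m).
{ intros u l m Hlm; rewrite <- (composem1 l), <- (composem1 m), <- K2.
  rewrite <- !composeA, Hlm; reflexivity. }
destruct (Hu t (a ∘ k) b Hab) as (l & [L1 L2] & U).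
exists l; split; [split; [apply K; rewrite composeA |]; assumption |].
intros l' [M1 M2]; apply U; split; [rewrite <- composeA, M1; reflexivity | exact M2].
Qed.

End PushoutFacts.

(** * Cancellation and uniqueness in a factorization system *)

Section FactorizationSystemFacts.
Variables (C : Category) (E M : mor_class C).
Hypothesis fs : factorization_system E M.

Lemma left_right_is_iso (x y : C) (f : hom x y) : E f -> M f -> is_iso f.
Proof.
intros Ef Mf.
assert (H : f ∘ idm x = idm y ∘ f) by (rewrite compose1m; apply composem1).
destruct (fs_orth fs Ef Mf H) as (w & W & _); exists w; exact W.
Qed.

(** Factorize [f] as [n ∘ e]. Orthogonality of [e] to [m ∘ f] gives a retraction [w] of [e], and
    [e ∘ w] is the identity because both are diagonals of [e] against [m ∘ n]. So [e] is invertible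
    and [f] lies in [M] with [n]. *)
Lemma right_class_cancel (x y z : C) (m : hom y z) (f : hom x y) :
  M m -> M (m ∘ f) -> M f.
Proof.
intros Mm Mmf.
destruct (fs_fact fs f) as (i & e & n & Ee & Mn & Hf).
assert (H : m ∘ f ∘ idm x = (m ∘ n) ∘ e) by (rewrite composem1, Hf, composeA; reflexivity).
destruct (fs_orth fs Ee Mmf H) as (w & [W1 W2] & _).
assert (ew : e ∘ w = idm i).
{ assert (Mmn : M (m ∘ n)) by exact (wcl_comp (fs_right fs) Mm Mn).
  destruct (fs_orth fs Ee Mmn (eq_refl (m ∘ n ∘ e))) as (k & _ & U).
  transitivity k; [symmetry |]; apply U; split.
  - rewrite composeA, W1; apply composem1.
  - rewrite <- W2 at 2; rewrite Hf, !composeA; reflexivity.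
  - apply compose1m.
  - apply composem1. }
rewrite Hf; apply (wcl_comp (fs_right fs) Mn), (wcl_iso (fs_right fs)).
exists w; split; assumption.
Qed.

Lemma factorization_unique (x y i i' : C) (e : hom x i) (m : hom i y)
    (e' : hom x i') (m' : hom i' y) :
  E e -> M m -> E e' -> M m' -> m ∘ e = m' ∘ e' ->
  exists (k : hom i i') (l : hom i' i),
    l ∘ k = idm i /\ k ∘ l = idm i' /\ k ∘ e = e' /\ m' ∘ k = m.
Proof.
intros Ee Mm Ee' Mm' H.
destruct (fs_orth fs Ee Mm' (eq_sym H)) as (k & [K1 K2] & _).
destruct (fs_orth fs Ee' Mm H) as (l & [L1 L2] & _).
exists k, l; repeat split; auto.
- destruct (fs_orth fs Ee Mm (eq_refl (m ∘ e))) as (j & _ & U).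
  transitivity j; [symmetry |]; apply U; split;
    rewrite ?compose1m, ?composem1; auto.
  + rewrite composeA, K1; exact L1.
  + rewrite <- composeA, L2; exact K2.
- destruct (fs_orth fs Ee' Mm' (eq_refl (m' ∘ e'))) as (j & _ & U).
  transitivity j; [symmetry |]; apply U; split;
    rewrite ?compose1m, ?composem1; auto.
  + rewrite composeA, L1; exact K1.
  + rewrite <- composeA, K2; exact L2.
Qed.

End FactorizationSystemFacts.

Lemma opposite_factorization_system (C : Category) (E M : mor_class C) :
  factorization_system E M ->
  factorization_system (C := opposite C) (fun x y f => M y x f) (fun x y f => E y x f).
Proof.
intros fs; split.
- split.
  + intros x y f (g & G1 & G2); apply (wcl_iso (fs_right fs)); exists g; auto.
  + intros x y z g f Mg Mf; exact (wcl_comp (fs_right fs) Mf Mg).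
- split.
  + intros x y f (g & G1 & G2); apply (wcl_iso (fs_left fs)); exists g; auto.
  + intros x y z g f Mg Mf; exact (wcl_comp (fs_left fs) Mf Mg).
- intros x y a b m e u v Mm Ee H.
  destruct (fs_orth fs Ee Mm (eq_sym H)) as (w & [W1 W2] & U).
  exists w; split; [split; assumption |]; intros w' [H1 H2]; apply U; split; assumption.
- intros x y f; destruct (fs_fact fs f) as (i & e & m & Ee & Mm & H).
  exists i, m, e; auto.
Qed.

Lemma left_class_cancel (C : Category) (E M : mor_class C) (x y z : C)
    (f : hom y z) (e : hom x y) :
  factorization_system E M -> E x y e -> E x z (f ∘ e) -> E y z f.
Proof.
intros fs; exact (right_class_cancel (opposite_factorization_system fs)
  (m := e : @hom (opposite C) y x) (f := f : @hom (opposite C) z y)).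
Qed.

(** * Bipullbacks in locally preordered bicategories *)

Definition thin (C : Category) : Prop := forall (x y : C) (f g : hom x y), f = g.

(** This instance and the [Proper] ones below allow rewriting 1-cells along invertible 2-cells, so
    that arbitrary members of the two classes can be replaced by actual stars. *)
#[global] Instance isomorphic_equivalence (C : Category) :
  Equivalence (@isomorphic C).
Proof.
split.
- intros x; constructor; exact {| iso_bwdK := compose1m (idm x); iso_fwdK := compose1m (idm x) |}.
- intros x y [i]; constructor; exact (iso_sym i).
- intros x y z [i] [j]; constructor; exact (iso_comp j i).
Qed.

#[global] Instance has_hom_proper (C : Category) :
  Proper (@isomorphic C ==> @isomorphic C ==> iff) (@has_hom C).
Proof.
intros x x' [i] y y' [j]; split; intros [f]; constructor.
- exact (iso_fwd j ∘ f ∘ iso_bwd i).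
- exact (iso_bwd j ∘ f ∘ iso_fwd i).
Qed.

Lemma isomorphic_le (C : Category) (x y : C) : x ≅ y -> x ≼ y.
Proof. intros [i]; constructor; exact (iso_fwd i). Qed.

Lemma thin_isomorphic (C : Category) (x y : C) :
  thin C -> x ≼ y -> y ≼ x -> x ≅ y.
Proof.
intros T [f] [g]; constructor.
exact {| iso_fwd := f; iso_bwd := g; iso_bwdK := T _ _ _ _; iso_fwdK := T _ _ _ _ |}.
Qed.

(** Between preorders every square of 2-cells commutes, so the iso-comma category is itself a
    preorder. Full faithfulness of the comparison becomes joint reflection of the order, and
    essential surjectivity becomes lifting of matching pairs. *)
Lemma thin_bipullback (A B B' D : Category) (F : Functor A B)
    (G : Functor A B') (H : Functor B D) (K : Functor B' D)
    (θ : nat_square F G H K) :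
  thin A -> thin B -> thin B' -> thin D ->
  (cat_bipullback θ <->
   (forall a a' : A, F a ≼ F a' -> G a ≼ G a' -> a ≼ a') /\
   (forall (b : B) (b' : B'), H b ≅ K b' -> exists a : A, F a ≅ b /\ G a ≅ b')).
Proof.
intros TA TB TB' TD; split.
- intros [HF HS]; split.
  + intros a a' [f] [g].
    destruct (HF a a' (@Build_isocomma_hom _ _ _ H K
      {| ic_fst := F a; ic_snd := G a; ic_iso := θ a |}
      {| ic_fst := F a'; ic_snd := G a'; ic_iso := θ a' |} f g (TD _ _ _ _)))
      as (h & _); constructor; exact h.
  + intros b b' [i].
    destruct (HS {| ic_fst := b; ic_snd := b'; ic_iso := i |}) as (a & [j]).
    exists a; split; apply thin_isomorphic; auto; constructor.
    * exact (ich_fst (iso_fwd j)).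
    * exact (ich_fst (iso_bwd j)).
    * exact (ich_snd (iso_fwd j)).
    * exact (ich_snd (iso_bwd j)).
- intros [HF HS].
  assert (TI : thin (isocomma H K)).
  { intros s t f g; apply isocomma_hom_eq; auto. }
  split.
  + intros a a' k.
    destruct (HF a a' (inhabits (ich_fst k)) (inhabits (ich_snd k))) as [h].
    exists h; split; [apply TI | intros; apply TA].
  + intros [b b' i]; destruct (HS b b' (inhabits i)) as (a & [j] & [j']).
    exists a; apply thin_isomorphic; [exact TI | |]; constructor.
    * exact (@Build_isocomma_hom _ _ _ H K
        {| ic_fst := F a; ic_snd := G a; ic_iso := θ a |}
        {| ic_fst := b; ic_snd := b'; ic_iso := i |}
        (iso_fwd j) (iso_fwd j') (TD _ _ _ _)).
    * exact (@Build_isocomma_hom _ _ _ H K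
        {| ic_fst := b; ic_snd := b'; ic_iso := i |}
        {| ic_fst := F a; ic_snd := G a; ic_iso := θ a |}
        (iso_bwd j) (iso_bwd j') (TD _ _ _ _)).
Qed.

#[global] Instance bcomp_proper (S : Bicategory) (x y z : S) :
  Proper (@isomorphic (bhom y z) ==> @isomorphic (bhom x y)
          ==> @isomorphic (bhom x z)) (@bcomp S x y z).
Proof.
intros g g' [i] f f' [j]; constructor.
refine {| iso_fwd := hcomp (iso_fwd i) (iso_fwd j);
          iso_bwd := hcomp (iso_bwd i) (iso_bwd j) |};
  rewrite <- hcompM, ?iso_bwdK, ?iso_fwdK; apply hcomp1.
Qed.

Lemma bcomp_assoc (S : Bicategory) (x y z t : S) (h : bhom z t)
    (g : bhom y z) (f : bhom x y) : h ⋅ g ⋅ f ≅ h ⋅ (g ⋅ f).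
Proof. constructor; apply bassoc. Qed.

Lemma bcomp_idr (S : Bicategory) (x y : S) (f : bhom x y) : f ⋅ bid x ≅ f.
Proof. constructor; apply brunit. Qed.

Section LocallyPreordered.
Variable S : Bicategory.
Hypothesis thinS : locally_preordered S.

Lemma bipullback_iff (x y z w : S) (f : bhom x z) (g : bhom y z)
    (p : bhom w x) (q : bhom w y) :
  is_bipullback f g p q <->
  f ⋅ p ≅ g ⋅ q /\
  forall t : S,
    (forall u v : bhom t w, p ⋅ u ≼ p ⋅ v -> q ⋅ u ≼ q ⋅ v -> u ≼ v) /\
    (forall (b : bhom t x) (b' : bhom t y), f ⋅ b ≅ g ⋅ b' ->
       exists u : bhom t w, p ⋅ u ≅ b /\ q ⋅ u ≅ b').
Proof.
assert (T : forall a b : S, thin (bhom a b)) by (intros a b f' g'; apply thinS).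
split.
- intros [φ H]; split; [exact (inhabits φ) |].
  intros t; exact (proj1 (thin_bipullback (hom_square φ t) (T _ _) (T _ _) (T _ _) (T _ _)) (H t)).
- intros [[φ] H]; exists φ; intros t.
  exact (proj2 (thin_bipullback (hom_square φ t) (T _ _) (T _ _) (T _ _) (T _ _)) (H t)).
Qed.

Lemma orthogonal_iff (x y a b : S) (e : bhom x y) (m : bhom a b) :
  cat_bipullback (orth_square e m) <->
  (forall u v : bhom y a, m ⋅ u ≼ m ⋅ v -> u ⋅ e ≼ v ⋅ e -> u ≼ v) /\
  (forall (u : bhom y b) (v : bhom x a), u ⋅ e ≅ m ⋅ v ->
     exists w : bhom y a, m ⋅ w ≅ u /\ w ⋅ e ≅ v).
Proof.
assert (T : forall a b : S, thin (bhom a b)) by (intros ? ? f g; apply thinS).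
exact (thin_bipullback (orth_square e m) (T _ _) (T _ _) (T _ _) (T _ _)).
Qed.

(** The characterization [bipullback_iff] does not mention the chosen invertible 2-cell, hence the
    legs may be exchanged for isomorphic ones. *)
#[local] Instance is_bipullback_proper (x y z w : S) :
  Proper (@isomorphic (bhom x z) ==> @isomorphic (bhom y z)
    ==> @isomorphic (bhom w x) ==> @isomorphic (bhom w y) ==> iff)
    (@is_bipullback S x y z w).
Proof.
intros f f' Hf g g' Hg p p' Hp q q' Hq.
rewrite !bipullback_iff; setoid_rewrite Hf; setoid_rewrite Hg.
setoid_rewrite Hp; setoid_rewrite Hq; reflexivity.
Qed.

(** Both [l ⋅ k] and the identity have, up to isomorphism, projections [p] and [q], and the
    projections jointly reflect the order. *)
Lemma bipullback_section (x y z w w' : S) (f : bhom x z) (g : bhom y z)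
    (p : bhom w x) (q : bhom w y) (k : bhom w w') (l : bhom w' w)
    (p' : bhom w' x) (q' : bhom w' y) :
  is_bipullback f g p q -> p' ⋅ k ≅ p -> q' ⋅ k ≅ q ->
  p ⋅ l ≅ p' -> q ⋅ l ≅ q' -> l ⋅ k ≅ bid w.
Proof.
intros H Kp Kq Lp Lq; apply bipullback_iff in H; destruct H as [_ H].
assert (Hp : p ⋅ (l ⋅ k) ≅ p ⋅ bid w)
  by (rewrite <- bcomp_assoc, Lp, Kp, bcomp_idr; reflexivity).
assert (Hq : q ⋅ (l ⋅ k) ≅ q ⋅ bid w)
  by (rewrite <- bcomp_assoc, Lq, Kq, bcomp_idr; reflexivity).
apply thin_isomorphic; [intros ? ? ? ?; apply thinS | |];
  apply (proj1 (H w)); apply isomorphic_le; assumption || (symmetry; assumption).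
Qed.

Lemma bipullback_unique (x y z w w' : S) (f : bhom x z) (g : bhom y z)
    (p : bhom w x) (q : bhom w y) (p' : bhom w' x) (q' : bhom w' y) :
  is_bipullback f g p q -> is_bipullback f g p' q' ->
  exists k : bhom w w', is_equivalence k /\ p' ⋅ k ≅ p /\ q' ⋅ k ≅ q.
Proof.
intros H H'.
pose proof (proj1 (bipullback_iff f g p q) H) as [Hc Hu].
pose proof (proj1 (bipullback_iff f g p' q') H') as [Hc' Hu'].
destruct (proj2 (Hu' w) _ _ Hc) as (k & K1 & K2).
destruct (proj2 (Hu w') _ _ Hc') as (l & L1 & L2).
exists k; split; [exists l; split | auto].
- exact (bipullback_section H K1 K2 L1 L2).
- exact (bipullback_section H' L1 L2 K1 K2).
Qed.

(** The second half of [has_bipullbacks_in] concerns every bipullback. One with projections in [K]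
    is enough, since any other differs from it by an equivalence, which lies in [K]. *)
Lemma has_bipullbacks_in_intro (K : cell_class S) :
  bicat_class K ->
  (forall (x y z : S) (f : bhom x z) (g : bhom y z), K x z f -> K y z g ->
     exists (w : S) (p : bhom w x) (q : bhom w y),
       K w x p /\ K w y q /\ is_bipullback f g p q) ->
  has_bipullbacks_in K.
Proof.
intros HK H x y z f g Kf Kg.
destruct (H x y z f g Kf Kg) as (w & p & q & Kp & Kq & Hpq); split; [eauto |].
intros w' p' q' H'.
destruct (bipullback_unique H' Hpq) as (k & Ek & K1 & K2).
apply (bcl_equiv HK) in Ek.
split; [apply (bcl_iso HK K1) | apply (bcl_iso HK K2)];
  apply (bcl_comp HK); assumption.
Qed.

End LocallyPreordered.

(** * Spans *)

Section Spans.
Variables (C : Category) (E M : mor_class C).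
Hypothesis HS : suitable E M.
Variable pb : pullback_choice E M.

Local Notation Sp := (Spn HS pb).
Local Notation fs := (sfs_fs HS).

Lemma Spn_locally_preordered : locally_preordered Sp.
Proof. intros U W r s α β; apply (span_mor_unique HS). Qed.

Lemma span_le_iff (U W : C) (r s : @bhom Sp U W) :
  r ≼ s <-> exists f : hom (apex r) (apex s),
    sleft s ∘ f = sleft r /\ sright s ∘ f = sright r.
Proof.
split.
- intros [α]; exists (smor α); split; [apply smor_left | apply smor_right].
- intros (f & F1 & F2); constructor; exact (Build_span_mor F1 F2).
Qed.

Lemma span_map_unique (U W : C) (r s : span E M U W) (f g : hom (apex r) (apex s)) :
  sleft s ∘ f = sleft r -> sright s ∘ f = sright r ->
  sleft s ∘ g = sleft r -> sright s ∘ g = sright r -> f = g.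
Proof.
intros F1 F2 G1 G2.
exact (f_equal (@smor _ _ _ _ _ _ _)
  (span_mor_unique HS (Build_span_mor F1 F2) (Build_span_mor G1 G2))).
Qed.

Lemma span_isomorphic (U W : C) (r s : @bhom Sp U W) : r ≼ s -> s ≼ r -> r ≅ s.
Proof. apply thin_isomorphic; intros x y f g; apply Spn_locally_preordered. Qed.

Lemma span_isomorphic_iff (U W : C) (r s : @bhom Sp U W) :
  r ≅ s <-> exists f : hom (apex r) (apex s),
    is_iso f /\ sleft s ∘ f = sleft r /\ sright s ∘ f = sright r.
Proof.
split.
- intros [i]; exists (smor (iso_fwd i)); split; [| split; [apply smor_left | apply smor_right]].
  exists (smor (iso_bwd i)); split.
  + exact (f_equal (@smor _ _ _ _ _ _ _) (iso_bwdK i)).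
  + exact (f_equal (@smor _ _ _ _ _ _ _) (iso_fwdK i)).
- intros (f & (g & G1 & G2) & F1 & F2).
  apply span_isomorphic; apply span_le_iff; [exists f; auto |].
  exists g; rewrite <- F1, <- F2, !composeA, G2, !composem1; auto.
Qed.

(** * Composites with lower and upper stars *)

Definition mkspan (U W R : C) (d : hom R U) (m : hom R W) (Ed : E d) (Mm : M m) :
    @bhom Sp U W :=
  {| apex := R; sleft := d; sright := m; sleft_E := Ed; sright_M := Mm |}.

(** Any pullback computes the composite, so the choice [pb] can be forgotten from here on whenever a
    convenient pullback is at hand. *)
Lemma span_comp_isomorphic (U V W : C) (s : @bhom Sp V W) (r : @bhom Sp U V)
    (t : @bhom Sp U W) (p : hom (apex t) (apex r)) (q : hom (apex t) (apex s)) :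
  is_pullback (sright r) (sleft s) p q ->
  sleft r ∘ p = sleft t -> sright s ∘ q = sright t -> s ⋅ r ≅ t.
Proof.
intros H H1 H2; symmetry; apply span_isomorphic_iff.
destruct (pullback_unique (pb_is_pullback (span_pb pb s r)) H) as (k & K & K1 & K2).
exists k; simpl; rewrite !composeA, K1, K2; auto.
Qed.

Lemma span_isomorphic_eq (U W : C) (r : @bhom Sp U W) (d : hom (apex r) U)
    (m : hom (apex r) W) (Ed : E d) (Mm : M m) :
  sleft r = d -> sright r = m -> r ≅ mkspan Ed Mm.
Proof.
intros H1 H2; apply span_isomorphic_iff; exists (idm _); simpl.
rewrite !composem1; split; [apply is_iso_idm | auto].
Qed.

Lemma pullback_along_idm (x y : C) (f : hom x y) :
  is_pullback f (idm y) (idm x) f.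
Proof.
apply pullback_intro.
- rewrite compose1m; apply composem1.
- intros t k l H _; rewrite !compose1m in H; exact H.
- intros t a b H; exists a; rewrite !compose1m in *; auto.
Qed.

(** A lower star has an identity left leg, and pulling back along an identity changes nothing: only
    the right leg of [r] grows. *)
Lemma lower_star_comp (U V W : C) (m : hom V W) (Mm : M m) (r : @bhom Sp U V)
    (Mr : M (m ∘ sright r)) :
  lower_star HS pb Mm ⋅ r ≅ mkspan (sleft_E r) Mr.
Proof.
apply (@span_comp_isomorphic U V W (lower_star HS pb Mm) r (mkspan (sleft_E r) Mr)
  (idm _) (sright r)); simpl.
- apply pullback_along_idm.
- apply composem1.
- reflexivity.
Qed.

Lemma comp_upper_star (U V W : C) (e : hom V U) (Ee : E e) (r : @bhom Sp V W)
    (Er : E (e ∘ sleft r)) :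
  r ⋅ upper_star HS pb Ee ≅ mkspan Er (sright_M r).
Proof.
apply (@span_comp_isomorphic U V W r (upper_star HS pb Ee) (mkspan Er (sright_M r))
  (sleft r) (idm _)); simpl.
- apply pullback_sym, pullback_along_idm.
- reflexivity.
- apply composem1.
Qed.

Lemma lower_star_lower_star (X Y Z : C) (m : hom Y Z) (n : hom X Y)
    (Mm : M m) (Mn : M n) (Mmn : M (m ∘ n)) :
  lower_star HS pb Mm ⋅ lower_star HS pb Mn ≅ lower_star HS pb Mmn.
Proof. exact (@lower_star_comp _ _ _ _ Mm (lower_star HS pb Mn) Mmn). Qed.

Lemma upper_star_upper_star (X Y Z : C) (e : hom Y Z) (d : hom X Y)
    (Ee : E e) (Ed : E d) (Eed : E (e ∘ d)) :
  upper_star HS pb Ed ⋅ upper_star HS pb Ee ≅ upper_star HS pb Eed.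
Proof. exact (@comp_upper_star _ _ _ _ Ee (upper_star HS pb Ed) Eed). Qed.

Lemma lower_star_upper_star (X Y Z : C) (m : hom X Z) (d : hom X Y)
    (Mm : M m) (Ed : E d) :
  lower_star HS pb Mm ⋅ upper_star HS pb Ed ≅ mkspan Ed Mm.
Proof.
assert (Mr : M (m ∘ idm X)) by (rewrite composem1; exact Mm).
rewrite (lower_star_comp (r := upper_star HS pb Ed) Mm Mr).
apply (span_isomorphic_eq (r := mkspan Ed Mr)); simpl;
  [reflexivity | apply composem1].
Qed.

Lemma lower_star_eq (X Y : C) (m n : hom X Y) (Mm : M m) (Mn : M n) :
  lower_star HS pb Mm ≼ lower_star HS pb Mn <-> m = n.
Proof.
rewrite span_le_iff; simpl; split.
- intros (f & F1 & F2); rewrite compose1m in F1; rewrite F1, composem1 in F2; auto.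
- intros H; exists (idm X); rewrite !composem1; auto.
Qed.

Lemma upper_star_eq (X Y : C) (d e : hom X Y) (Ed : E d) (Ee : E e) :
  upper_star HS pb Ed ≼ upper_star HS pb Ee <-> d = e.
Proof.
rewrite span_le_iff; simpl; split.
- intros (f & F1 & F2); rewrite compose1m in F2; rewrite F2, composem1 in F1; auto.
- intros H; exists (idm X); rewrite !composem1; auto.
Qed.

Lemma lower_star_isomorphic (X Y : C) (m n : hom X Y) (Mm : M m) (Mn : M n) :
  m = n -> lower_star HS pb Mm ≅ lower_star HS pb Mn.
Proof. intros H; apply span_isomorphic; apply lower_star_eq; auto. Qed.

Lemma upper_star_isomorphic (X Y : C) (d e : hom X Y) (Ed : E d) (Ee : E e) :
  d = e -> upper_star HS pb Ed ≅ upper_star HS pb Ee.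
Proof. intros H; apply span_isomorphic; apply upper_star_eq; auto. Qed.

(** In V2 a single comparison 1-cell must compose well with members of both classes. An isomorphism
    provides one, being a lower star and an upper star at once. *)
Lemma lower_star_inverse (X Y : C) (f : hom X Y) (g : hom Y X) (Mf : M f) (Eg : E g) :
  g ∘ f = idm X -> f ∘ g = idm Y -> lower_star HS pb Mf ≅ upper_star HS pb Eg.
Proof.
intros H1 H2; apply span_isomorphic_iff; exists f; simpl.
rewrite compose1m; split; [exists g; auto | auto].
Qed.

Lemma lower_star_of_iso (X Y : C) (f : @bhom Sp X Y) :
  is_iso (sleft f) ->
  exists (m : hom X Y) (Mm : M m), m ∘ sleft f = sright f /\ f ≅ lower_star HS pb Mm.
Proof.
intros (d & D1 & D2).
assert (Mm : M (sright f ∘ d)).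
{ apply (wcl_comp (fs_right fs) (sright_M f)), (wcl_iso (fs_right fs)).
  exists (sleft f); auto. }
assert (H : sright f ∘ d ∘ sleft f = sright f)
  by (rewrite composeA, D1; apply composem1).
exists (sright f ∘ d), Mm; split; [exact H |].
apply span_isomorphic_iff; exists (sleft f); simpl.
rewrite compose1m; split; [exists d; auto | auto].
Qed.

Lemma upper_star_of_iso (X Y : C) (f : @bhom Sp X Y) :
  is_iso (sright f) ->
  exists (e : hom Y X) (Ee : E e), e ∘ sright f = sleft f /\ f ≅ upper_star HS pb Ee.
Proof.
intros (d & D1 & D2).
assert (Ee : E (sleft f ∘ d)).
{ apply (wcl_comp (fs_left fs) (sleft_E f)), (wcl_iso (fs_left fs)).
  exists (sright f); auto. }
assert (H : sleft f ∘ d ∘ sright f = sleft f)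
  by (rewrite composeA, D1; apply composem1).
exists (sleft f ∘ d), Ee; split; [exact H |].
apply span_isomorphic_iff; exists (sright f); simpl.
rewrite compose1m; split; [exists d; auto | auto].
Qed.

(** * Equivalences in the bicategory of spans *)

Lemma span_legs_pushout (U V W : C) (m : hom U W) (e : hom V W) (P : C)
    (p : hom P U) (q : hom P V) :
  M m -> E e -> is_pullback m e p q -> is_pushout p q m e.
Proof.
intros Mm Ee H; apply pushout_sym.
apply (sfs_5 HS (right_class_pullback fs Mm H) Mm (sfs_3 HS Mm Ee H) Ee).
- symmetry; apply H.
- apply pullback_sym; exact H.
Qed.

Lemma comp_unit_legs (U W : C) (f : @bhom Sp U W) (g : @bhom Sp W U) :
  g ⋅ f ≅ @bid Sp U -> exists (P : C) (p : hom P (apex f)) (q : hom P (apex g)),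
    is_pullback (sright f) (sleft g) p q /\ is_pushout p q (sright f) (sleft g) /\
    E p /\ M q /\ sleft f ∘ p = sright g ∘ q /\ is_iso (sleft f ∘ p).
Proof.
intros H; apply span_isomorphic_iff in H; destruct H as (k & Hk & K1 & K2).
pose (P := span_pb pb g f); simpl in *.
rewrite compose1m in K1, K2.
exists (pb_ob P), (pb_fst P), (pb_snd P).
assert (HP := pb_is_pullback P).
split; [exact HP |]; split; [exact (span_legs_pushout (sright_M f) (sleft_E g) HP) |].
split; [exact (sfs_3 HS (sright_M f) (sleft_E g) HP) |].
split; [exact (right_class_pullback fs (sright_M f) HP) |].
split; [exact (eq_trans (eq_sym K1) K2) |].
exact (eq_ind _ (fun h => is_iso h) Hk _ K1).
Qed.

(** The apexes of [g ⋅ f] and [f ⋅ g] are pullbacks [P] and [P'], and by (SFS5) also give pushouts.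
    Their universal properties yield maps [h] and [k] that link the two unit isomorphisms, and the
    legs are then inverted one after the other. *)
Lemma equivalence_legs (U W : C) (f : @bhom Sp U W) :
  is_equivalence f -> is_iso (sleft f) /\ is_iso (sright f).
Proof.
intros (g & Hgf & Hfg).
destruct (comp_unit_legs Hgf) as (P & p & q & HP & HO & Ep & Mq & Hc & Hi).
destruct (comp_unit_legs Hfg) as (P' & p' & q' & HP' & HO' & Ep' & Mq' & Hc' & Hi').
(* The commuting square [Hc] serves twice: as a cocone under the pushout from [P], and as a cone
   over the pullback [P']. *)
destruct (pushout_desc HO Hc) as (h & H1 & H2).
destruct (pullback_lift HP' (eq_sym Hc)) as (k & K1 & K2).
assert (Iq' : is_iso q').
(* With [k = m ∘ e], the map [q' ∘ m] is in [M], and in [E] because precomposing it with [e] gives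
   [p]. Hence it is invertible, and [q'] sits between two invertible composites. *)
{ destruct (fs_fact fs k) as (I & e & m & Ee & Mm & Hk).
  assert (Hs : is_iso (q' ∘ m)).
  { apply (left_right_is_iso fs).
    - apply (left_class_cancel (f := q' ∘ m) (e := e) fs Ee).
      rewrite composeA, <- Hk, K2; exact Ep.
    - exact (wcl_comp (fs_right fs) Mq' Mm). }
  apply (@is_iso_middle _ _ _ _ _ (sright f) q' m); [rewrite <- Hc'; exact Hi' | exact Hs]. }
assert (Im : is_iso (sright f))
  by (apply (is_iso_cancel_right Iq'); rewrite <- Hc'; exact Hi').
assert (Iq : is_iso q).
{ apply (left_right_is_iso fs); [| exact Mq].
  rewrite <- K1; apply (wcl_comp (fs_left fs) Ep').
  destruct Iq' as (r & R1 & R2).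
  rewrite <- (compose1m k), <- R1, composeA, K2.
  apply (wcl_comp (fs_left fs)); [| exact Ep].
  apply (wcl_iso (fs_left fs)); exists q'; auto. }
assert (In : is_iso (sright g))
  by (apply (is_iso_cancel_right Iq); rewrite <- Hc; exact Hi).
assert (Id' : is_iso (sleft g))
  by (apply (@is_iso_middle _ _ _ _ _ h _ p'); [rewrite H2 |]; assumption).
split; [| exact Im].
apply (is_iso_cancel_right Iq'); rewrite <- (proj1 HP').
apply is_iso_comp; [exact In | exact (is_iso_cancel_left Id' Hi')].
Qed.

(** * The factorization system on spans *)

Lemma M_lower_star_bicat_class : bicat_class (M_lower_star HS pb).
Proof.
split.
- intros X Y f Hf; destruct (lower_star_of_iso (proj1 (equivalence_legs Hf)))
    as (m & Mm & _ & H); exists m, Mm; exact H.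
- intros X Y Z g f (m & Mm & Hm) (n & Mn & Hn).
  exists (m ∘ n), (wcl_comp (fs_right fs) Mm Mn).
  rewrite Hm, Hn; apply lower_star_lower_star.
- intros X Y f g H (m & Mm & Hm); exists m, Mm; rewrite <- H; exact Hm.
Qed.

Lemma E_upper_star_bicat_class : bicat_class (E_upper_star HS pb).
Proof.
split.
- intros X Y f Hf; destruct (upper_star_of_iso (proj2 (equivalence_legs Hf)))
    as (e & Ee & _ & H); exists e, Ee; exact H.
- intros X Y Z g f (d & Ed & Hd) (e & Ee & He).
  exists (e ∘ d), (wcl_comp (fs_left fs) Ee Ed).
  rewrite Hd, He; apply upper_star_upper_star.
- intros X Y f g H (e & Ee & He); exists e, Ee; rewrite <- H; exact He.
Qed.

(** Composing with [u] alters only left legs and composing with [l] only right legs, so the two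
    operations are independent. *)
Lemma star_orthogonal (X Y A B : C) (u : @bhom Sp X Y) (l : @bhom Sp A B) :
  E_upper_star HS pb X Y u -> M_lower_star HS pb A B l -> cat_bipullback (orth_square u l).
Proof.
intros (e & Ee & He) (m & Mm & Hm).
apply (orthogonal_iff Spn_locally_preordered u l); split.
- intros r s; rewrite He, Hm.
  rewrite (lower_star_comp Mm (wcl_comp (fs_right fs) Mm (sright_M r))).
  rewrite (lower_star_comp Mm (wcl_comp (fs_right fs) Mm (sright_M s))).
  rewrite (comp_upper_star Ee (wcl_comp (fs_left fs) Ee (sleft_E r))).
  rewrite (comp_upper_star Ee (wcl_comp (fs_left fs) Ee (sleft_E s))).
  rewrite !span_le_iff; simpl; intros (f & F1 & F2) (g & G1 & G2).
  (* Both are 2-cells between the same spans once each span is extended on both sides, and such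
     2-cells are unique. *)
  assert (H : f = g).
  { apply (@span_map_unique _ _
      (mkspan (wcl_comp (fs_left fs) Ee (sleft_E r)) (wcl_comp (fs_right fs) Mm (sright_M r)))
      (mkspan (wcl_comp (fs_left fs) Ee (sleft_E s)) (wcl_comp (fs_right fs) Mm (sright_M s)))
      f g); simpl; rewrite ?composeA in *; congruence. }
  exists f; split; [exact F1 | rewrite H; exact G2].
- intros r s; rewrite He, Hm.
  rewrite (lower_star_comp Mm (wcl_comp (fs_right fs) Mm (sright_M s))).
  rewrite (comp_upper_star Ee (wcl_comp (fs_left fs) Ee (sleft_E r))).
  intros H; apply span_isomorphic_iff in H; simpl in H.
  destruct H as (f & If & F1 & F2).
  assert (Mw : M (sright s ∘ f))
    by (apply (wcl_comp (fs_right fs) (sright_M s)), (wcl_iso (fs_right fs) If)).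
  (* The diagonal takes its left leg from [r] and its right leg from [s], transported along the
     isomorphism [f] of apexes. *)
  exists (mkspan (sleft_E r) Mw).
  rewrite He, Hm.
  assert (Mw' : M (m ∘ (sright s ∘ f))) by (rewrite <- composeA, F2; apply sright_M).
  rewrite (lower_star_comp (r := mkspan (sleft_E r) Mw) Mm Mw').
  rewrite (comp_upper_star (r := mkspan (sleft_E r) Mw) Ee
    (wcl_comp (fs_left fs) Ee (sleft_E r))).
  split; apply span_isomorphic_iff; simpl.
  + exists (idm _); rewrite !composem1, <- composeA.
    split; [apply is_iso_idm | auto].
  + exists f; auto.
Qed.

Lemma star_factorization_system :
  bicat_factorization_system (E_upper_star HS pb) (M_lower_star HS pb).
Proof.
split.
- exact E_upper_star_bicat_class.
- exact M_lower_star_bicat_class.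
- intros X Y A B; apply star_orthogonal.
- intros X Y f; exists (apex f), (upper_star HS pb (sleft_E f)),
    (lower_star HS pb (sright_M f)); split; [| split].
  + exists (sleft f), (sleft_E f); reflexivity.
  + exists (sright f), (sright_M f); reflexivity.
  + rewrite lower_star_upper_star; apply span_isomorphic_eq; reflexivity.
Qed.

(** * Bipullbacks of lower stars *)

#[local] Instance Spn_bipullback_proper (x y z w : Sp) :
  Proper (@isomorphic (bhom x z) ==> @isomorphic (bhom y z)
    ==> @isomorphic (bhom w x) ==> @isomorphic (bhom w y) ==> iff)
    (@is_bipullback Sp x y z w) :=
  @is_bipullback_proper Sp Spn_locally_preordered x y z w.

(** Only right legs change under lower stars, so the pullback property in [C] is applied to right
    legs while left legs stay fixed. *)
Lemma lower_star_bipullback_of_pullback (X Y Z W : C) (m : hom X Z) (n : hom Y Z)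
    (p : hom W X) (q : hom W Y) (Mm : M m) (Mn : M n) (Mp : M p) (Mq : M q) :
  is_pullback m n p q ->
  is_bipullback (lower_star HS pb Mm) (lower_star HS pb Mn)
    (lower_star HS pb Mp) (lower_star HS pb Mq).
Proof.
intros H.
assert (Mc := fun x y z (g : hom y z) (f : hom x y) => @wcl_comp _ _ (fs_right fs) x y z g f).
apply (bipullback_iff Spn_locally_preordered); split.
{ rewrite (lower_star_lower_star Mm Mp (Mc _ _ _ _ _ Mm Mp)).
  rewrite (lower_star_lower_star Mn Mq (Mc _ _ _ _ _ Mn Mq)).
  apply lower_star_isomorphic, H. }
intros T; split.
- intros r s.
  rewrite (lower_star_comp Mp (Mc _ _ _ _ _ Mp (sright_M r))).
  rewrite (lower_star_comp Mp (Mc _ _ _ _ _ Mp (sright_M s))).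
  rewrite (lower_star_comp Mq (Mc _ _ _ _ _ Mq (sright_M r))).
  rewrite (lower_star_comp Mq (Mc _ _ _ _ _ Mq (sright_M s))).
  rewrite !span_le_iff; simpl; intros (f & F1 & F2) (g & G1 & G2).
  (* After composing further to [Z] the two maps become parallel 2-cells of spans, hence agree. *)
  assert (Hfg : f = g).
  { assert (Mr := Mc _ _ _ _ _ Mm (Mc _ _ _ _ _ Mp (sright_M r))).
    assert (Ms := Mc _ _ _ _ _ Mm (Mc _ _ _ _ _ Mp (sright_M s))).
    apply (@span_map_unique _ _ (mkspan (sleft_E r) Mr) (mkspan (sleft_E s) Ms) f g);
      simpl; auto.
    - rewrite composeA, F2; reflexivity.
    - rewrite <- !composeA, (proj1 H), !composeA, <- (composeA q), G2; reflexivity. }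
  exists f; split; [exact F1 |].
  rewrite <- Hfg in G2; rewrite composeA in F2, G2; exact (pullback_ext H F2 G2).
- intros r s.
  rewrite (lower_star_comp Mm (Mc _ _ _ _ _ Mm (sright_M r))).
  rewrite (lower_star_comp Mn (Mc _ _ _ _ _ Mn (sright_M s))).
  intros Hrs; apply span_isomorphic_iff in Hrs; simpl in Hrs.
  destruct Hrs as (f & If & F1 & F2).
  rewrite composeA in F2; symmetry in F2.
  destruct (pullback_lift H F2) as (k & K1 & K2).
  assert (Mk : M k)
    by (apply (right_class_cancel fs Mp); rewrite K1; apply sright_M).
  exists (mkspan (sleft_E r) Mk); split.
  + rewrite (lower_star_comp (r := mkspan (sleft_E r) Mk) Mp (Mc _ _ _ _ _ Mp Mk)).
    symmetry; exact (span_isomorphic_eq (r := r) (sleft_E r)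
      (Mc _ _ _ _ _ Mp Mk) eq_refl (eq_sym K1)).
  + rewrite (lower_star_comp (r := mkspan (sleft_E r) Mk) Mq (Mc _ _ _ _ _ Mq Mk)).
    apply span_isomorphic_iff; exists f; auto.
Qed.

Lemma lower_star_bipullback_iff (X Y Z W : C) (m : hom X Z) (n : hom Y Z)
    (p : hom W X) (q : hom W Y) (Mm : M m) (Mn : M n) (Mp : M p) (Mq : M q) :
  is_bipullback (lower_star HS pb Mm) (lower_star HS pb Mn)
    (lower_star HS pb Mp) (lower_star HS pb Mq) <->
  is_pullback m n p q.
Proof.
split; [| apply lower_star_bipullback_of_pullback].
(* A genuine pullback also gives a bipullback. The equivalence between the two is the lower star of
   an isomorphism of [C], along which the pullback property is carried back. *)
intros H; destruct (sfs_1 HS n Mm) as (W0 & p0 & q0 & H0).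
assert (Mq0 := right_class_pullback fs Mm H0).
assert (Mp0 := right_class_pullback fs Mn (pullback_sym H0)).
destruct (bipullback_unique Spn_locally_preordered H
  (lower_star_bipullback_of_pullback Mm Mn Mp0 Mq0 H0)) as (k & Hk & K1 & K2).
destruct (equivalence_legs Hk) as [I1 I2].
destruct (lower_star_of_iso I1) as (l & Ml & L1 & L2).
rewrite L2 in K1, K2.
rewrite (lower_star_lower_star Mp0 Ml (wcl_comp (fs_right fs) Mp0 Ml)) in K1.
rewrite (lower_star_lower_star Mq0 Ml (wcl_comp (fs_right fs) Mq0 Ml)) in K2.
apply isomorphic_le, lower_star_eq in K1; apply isomorphic_le, lower_star_eq in K2.
rewrite <- K1, <- K2; apply pullback_comp_iso; [| exact H0].
apply (is_iso_cancel_right I1); rewrite L1; exact I2.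
Qed.

(** * Spans as cospans, and bipullbacks of upper stars *)

(* By (SFS5) a span is equally well given by the cospan that is the pushout of
   its legs. *)
Record span_cospan (U W S : C) (r : @bhom Sp U W) (i : hom U S) (j : hom W S) : Prop := {
  cospan_pushout : is_pushout (sleft r) (sright r) i j;
  cospan_left_M : M i;
  cospan_right_E : E j
}.

Lemma span_cospan_pullback (U W S : C) (r : @bhom Sp U W) (i : hom U S) (j : hom W S) :
  span_cospan r i j -> is_pullback i j (sleft r) (sright r).
Proof.
intros [H Mi Ej]; apply pullback_sym.
apply (sfs_5 HS (sright_M r) Mi (sleft_E r) Ej);
  [symmetry; apply H | apply pushout_sym; exact H].
Qed.

Lemma span_cospan_exists (U W : C) (r : @bhom Sp U W) :
  exists (S : C) (i : hom U S) (j : hom W S), span_cospan r i j.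
Proof.
destruct (sfs_2 HS (sright r) (sleft_E r)) as (S & i & j & H).
exists S, i, j; split; [exact H | |].
- exact (sfs_4 HS (sleft_E r) (sright_M r) H).
- exact (left_class_pushout fs (sleft_E r) H).
Qed.

Lemma cospan_span_exists (U W S : C) (i : hom U S) (j : hom W S) :
  M i -> E j -> exists r : @bhom Sp U W, span_cospan r i j.
Proof.
intros Mi Ej; destruct (sfs_1 HS j Mi) as (P & p & q & H).
exists (mkspan (sfs_3 HS Mi Ej H) (right_class_pullback fs Mi H)).
split; [exact (span_legs_pushout Mi Ej H) | exact Mi | exact Ej].
Qed.

(** The direction of 2-cells is preserved. A map of apexes induces a map of pushouts, and a map of
    cospans induces one of pullbacks. *)
Lemma cospan_le_iff (U W S S' : C) (r s : @bhom Sp U W) (i : hom U S) (j : hom W S)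
    (i' : hom U S') (j' : hom W S') :
  span_cospan r i j -> span_cospan s i' j' ->
  (r ≼ s <-> exists f : hom S S', f ∘ i = i' /\ f ∘ j = j').
Proof.
intros Hr Hs; rewrite span_le_iff; split.
- intros (f & F1 & F2); apply (pushout_desc (cospan_pushout Hr)).
  rewrite <- F1, <- F2, <- !composeA, (proj1 (cospan_pushout Hs)); reflexivity.
- intros (f & F1 & F2); apply (pullback_lift (span_cospan_pullback Hs)).
  rewrite <- F1, <- F2, !composeA, (proj1 (cospan_pushout Hr)); reflexivity.
Qed.

(** By pasting of pushouts, an upper star acts on cospans by precomposing the right leg, just as a
    lower star acts on spans by postcomposing it. This makes the upper star case dual to the lower
    star one. *)
Lemma upper_star_cospan (U V W S : C) (e : hom W V) (Ee : E e) (r : @bhom Sp U V)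
    (i : hom U S) (j : hom V S) :
  span_cospan r i j -> span_cospan (upper_star HS pb Ee ⋅ r) i (j ∘ e).
Proof.
intros [H Mi Ej]; split; [simpl | exact Mi | exact (wcl_comp (fs_left fs) Ej Ee)].
rewrite compose1m; refine (pushout_paste _ H).
exact (span_legs_pushout (sright_M r) Ee (pb_is_pullback _)).
Qed.

Lemma upper_star_bipullback_of_pushout (X Y Z W : C) (d : hom Z X) (e : hom Z Y)
    (i : hom X W) (j : hom Y W) (Ed : E d) (Ee : E e) (Ei : E i) (Ej : E j) :
  is_pushout d e i j ->
  is_bipullback (upper_star HS pb Ed) (upper_star HS pb Ee)
    (upper_star HS pb Ei) (upper_star HS pb Ej).
Proof.
intros H.
apply (bipullback_iff Spn_locally_preordered); split.
{ rewrite (upper_star_upper_star Ei Ed (wcl_comp (fs_left fs) Ei Ed)).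
  rewrite (upper_star_upper_star Ej Ee (wcl_comp (fs_left fs) Ej Ee)).
  apply upper_star_isomorphic, H. }
intros T; split.
- intros r s.
  destruct (span_cospan_exists r) as (S & a & b & Hr).
  destruct (span_cospan_exists s) as (S' & a' & b' & Hs).
  rewrite (cospan_le_iff (upper_star_cospan Ei Hr) (upper_star_cospan Ei Hs)).
  rewrite (cospan_le_iff (upper_star_cospan Ej Hr) (upper_star_cospan Ej Hs)).
  rewrite (cospan_le_iff Hr Hs).
  intros (f & F1 & F2) (g & G1 & G2).
  assert (Hfg : f = g).
  { apply (pushout_ext (cospan_pushout (upper_star_cospan Ed (upper_star_cospan Ei Hr)))).
    - congruence.
    - rewrite <- composeA, F2, !composeA, (proj1 H), <- !composeA, <- G2, !composeA.
      reflexivity. }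
  exists f; split; [exact F1 |].
  rewrite <- Hfg, <- composeA in G2; rewrite <- composeA in F2.
  exact (pushout_ext H F2 G2).
- intros r s Hrs.
  destruct (span_cospan_exists r) as (S & a & b & Hr).
  destruct (span_cospan_exists s) as (S' & a' & b' & Hs).
  assert (Hr' := upper_star_cospan Ed Hr); assert (Hs' := upper_star_cospan Ee Hs).
  pose proof (proj1 (cospan_le_iff Hr' Hs') (isomorphic_le Hrs)) as (f & F1 & F2).
  symmetry in Hrs.
  pose proof (proj1 (cospan_le_iff Hs' Hr') (isomorphic_le Hrs)) as (g & G1 & G2).
  (* This is what allows [g] to carry the cospan built below back to the cospan of [r]. *)
  assert (Hgf : g ∘ f = idm S).
  { apply (pushout_ext (cospan_pushout Hr')); rewrite composeA, compose1m; congruence. }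
  rewrite <- composeA in F2.
  destruct (pushout_desc H F2) as (k & K1 & K2).
  assert (Ek : E k).
  { apply (left_class_cancel (f := k) (e := j) fs Ej); rewrite K2.
    exact (cospan_right_E Hs). }
  (* The mediating span is read off from a cospan with the left leg of the cospan of [s] and the
     right leg [k] induced by the pushout. *)
  destruct (cospan_span_exists (cospan_left_M Hs) Ek) as (w & Hw).
  exists w; split; apply span_isomorphic.
  + apply (cospan_le_iff (upper_star_cospan Ei Hw) Hr); exists g.
    rewrite K1, <- composeA, Hgf, compose1m; auto.
  + apply (cospan_le_iff Hr (upper_star_cospan Ei Hw)); exists f; auto.
  + apply (cospan_le_iff (upper_star_cospan Ej Hw) Hs); exists (idm S').
    rewrite !compose1m; auto.
  + apply (cospan_le_iff Hs (upper_star_cospan Ej Hw)); exists (idm S').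
    rewrite !compose1m; auto.
Qed.

Lemma upper_star_bipullback_iff (X Y Z W : C) (d : hom Z X) (e : hom Z Y)
    (i : hom X W) (j : hom Y W) (Ed : E d) (Ee : E e) (Ei : E i) (Ej : E j) :
  is_bipullback (upper_star HS pb Ed) (upper_star HS pb Ee)
    (upper_star HS pb Ei) (upper_star HS pb Ej) <->
  is_pushout d e i j.
Proof.
split; [| apply upper_star_bipullback_of_pushout].
intros H; destruct (sfs_2 HS e Ed) as (W0 & i0 & j0 & H0).
assert (Ej0 := left_class_pushout fs Ed H0).
assert (Ei0 := left_class_pushout fs Ee (pushout_sym H0)).
destruct (bipullback_unique Spn_locally_preordered H
  (upper_star_bipullback_of_pushout Ed Ee Ei0 Ej0 H0)) as (k & Hk & K1 & K2).
destruct (equivalence_legs Hk) as [I1 I2].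
destruct (upper_star_of_iso I2) as (l & El & L1 & L2).
rewrite L2 in K1, K2.
rewrite (upper_star_upper_star El Ei0 (wcl_comp (fs_left fs) El Ei0)) in K1.
rewrite (upper_star_upper_star El Ej0 (wcl_comp (fs_left fs) El Ej0)) in K2.
apply isomorphic_le, upper_star_eq in K1; apply isomorphic_le, upper_star_eq in K2.
rewrite <- K1, <- K2; apply pushout_comp_iso; [| exact H0].
apply (is_iso_cancel_right I2); rewrite L1; exact I1.
Qed.

(** * The condition V1 for both classes *)

Lemma lower_star_bipullbacks : has_bipullbacks_in (M_lower_star HS pb).
Proof.
apply (has_bipullbacks_in_intro Spn_locally_preordered M_lower_star_bicat_class).
intros X Y Z f g (m & Mm & Hm) (n & Mn & Hn).
destruct (sfs_1 HS n Mm) as (W & p & q & H).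
assert (Mq := right_class_pullback fs Mm H).
assert (Mp := right_class_pullback fs Mn (pullback_sym H)).
exists W, (lower_star HS pb Mp), (lower_star HS pb Mq); split; [| split].
- exists p, Mp; reflexivity.
- exists q, Mq; reflexivity.
- rewrite Hm, Hn; apply lower_star_bipullback_iff; exact H.
Qed.

Lemma upper_star_bipullbacks : has_bipullbacks_in (E_upper_star HS pb).
Proof.
apply (has_bipullbacks_in_intro Spn_locally_preordered E_upper_star_bicat_class).
intros X Y Z f g (d & Ed & Hd) (e & Ee & He).
destruct (sfs_2 HS e Ed) as (W & i & j & H).
assert (Ej := left_class_pushout fs Ed H).
assert (Ei := left_class_pushout fs Ee (pushout_sym H)).
exists W, (upper_star HS pb Ei), (upper_star HS pb Ej); split; [| split].
- exists i, Ei; reflexivity.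
- exists j, Ej; reflexivity.
- rewrite Hd, He; apply upper_star_bipullback_iff; exact H.
Qed.

(** * Fake pullbacks *)

(** The target has the pullback of [n] and [e] as its apex, so a 2-cell into it from the span with
    legs [d] and [m] is a cone with these projections. *)
Lemma fake_square_iff (W X Y Z : C) (m : hom Y Z) (d : hom Y W) (e : hom Z X)
    (n : hom W X) (Mm : M m) (Ed : E d) (Ee : E e) (Mn : M n) :
  lower_star HS pb Mm ⋅ upper_star HS pb Ed ≼ upper_star HS pb Ee ⋅ lower_star HS pb Mn
  <-> n ∘ d = e ∘ m.
Proof.
rewrite lower_star_upper_star, span_le_iff; simpl.
pose (P := span_pb pb (upper_star HS pb Ee) (lower_star HS pb Mn)).
assert (HP := pb_is_pullback P); simpl in HP; split.
- intros (f & F1 & F2); rewrite compose1m in F1, F2.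
  rewrite <- F1, <- F2, <- !composeA; f_equal; apply HP.
- intros H; destruct (pullback_lift HP H) as (k & K1 & K2).
  exists k; rewrite !compose1m; auto.
Qed.

Lemma invertible_square_pullback (W X Y Z : C) (m : hom Y Z) (d : hom Y W)
    (e : hom Z X) (n : hom W X) (Mm : M m) (Ed : E d) (Ee : E e) (Mn : M n) :
  upper_star HS pb Ee ⋅ lower_star HS pb Mn ≅ lower_star HS pb Mm ⋅ upper_star HS pb Ed ->
  is_pullback n e d m.
Proof.
rewrite lower_star_upper_star; intros H; symmetry in H.
apply span_isomorphic_iff in H; simpl in H.
destruct H as (f & If & F1 & F2); rewrite compose1m in F1, F2.
rewrite <- F1, <- F2; apply pullback_comp_iso; [exact If |].
exact (pb_is_pullback (span_pb pb (upper_star HS pb Ee) (lower_star HS pb Mn))).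
Qed.

(** * The conditions V2, V3 and V4 *)

Lemma Spn_V2 : fpr_V2 (E_upper_star HS pb) (M_lower_star HS pb).
Proof.
intros X Y Z a x (e & Ee & He) (m & Mm & Hm); split.
- destruct (fs_fact fs (e ∘ m)) as (W & d & n & Ed & Mn & H).
  exists W, (upper_star HS pb Ed), (lower_star HS pb Mn); split; [| split].
  + exists d, Ed; reflexivity.
  + exists n, Mn; reflexivity.
  (* Stating the goal with [≼] makes the [Proper] instance for [has_hom] available to the
     rewriting. *)
  + change (x ⋅ upper_star HS pb Ed ≼ a ⋅ lower_star HS pb Mn).
    rewrite He, Hm; apply fake_square_iff; auto.
- intros W W' b y b' y' ((d & Ed & Hd) & (n & Mn & Hn) & H)
    ((d' & Ed' & Hd') & (n' & Mn' & Hn') & H').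
  fold (has_hom (x ⋅ b) (a ⋅ y)) in H; fold (has_hom (x ⋅ b') (a ⋅ y')) in H'.
  rewrite He, Hm, Hd, Hn in H; rewrite He, Hm, Hd', Hn' in H'.
  apply fake_square_iff in H; apply fake_square_iff in H'.
  destruct (factorization_unique fs Ed Mn Ed' Mn' (eq_trans H (eq_sym H')))
    as (k & l & K1 & K2 & K3 & K4).
  assert (Ik : is_iso k) by (exists l; auto).
  assert (Il : is_iso l) by (exists k; auto).
  assert (Mk := wcl_iso (fs_right fs) Ik); assert (Ml := wcl_iso (fs_right fs) Il).
  assert (El := wcl_iso (fs_left fs) Il).
  exists (lower_star HS pb Mk); split; [| split].
  + exists (lower_star HS pb Ml); split.
    * rewrite (lower_star_lower_star Ml Mk (wcl_comp (fs_right fs) Ml Mk)).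
      apply (lower_star_isomorphic _ (right_class_id fs W)); exact K1.
    * rewrite (lower_star_lower_star Mk Ml (wcl_comp (fs_right fs) Mk Ml)).
      apply (lower_star_isomorphic _ (right_class_id fs W')); exact K2.
  (* To compose with an upper star, the lower star of [k] is turned into the upper star of its
     inverse [l]. *)
  + rewrite Hd, Hd', (lower_star_inverse Mk El K1 K2).
    rewrite (upper_star_upper_star El Ed' (wcl_comp (fs_left fs) El Ed')).
    apply upper_star_isomorphic; rewrite <- K3, <- composeA, K1; apply compose1m.
  + rewrite Hn, Hn'.
    rewrite (lower_star_lower_star Mn' Mk (wcl_comp (fs_right fs) Mn' Mk)).
    apply lower_star_isomorphic; exact K4.
Qed.

Lemma Spn_V3 : fpr_V3 (E_upper_star HS pb) (M_lower_star HS pb).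
Proof.
intros X Y Z A B D I J x y r s t a b c v d w
  (x' & Mx & Hx) (y' & My & Hy) (r' & Mr & Hr) (s' & Ms & Hs) (t' & Mt & Ht)
  (a' & Ea & Ha) (b' & Eb & Hb) Hbip H
  (c' & Ec & Hc) (v' & Mv & Hv) Hax (d' & Ed & Hd) (w' & Mw & Hw) Hby.
fold (has_hom (t ⋅ a) (b ⋅ s)) in H.
rewrite Hs, Hy, Hx, Hr in Hbip; apply lower_star_bipullback_iff in Hbip.
rewrite Ht, Ha, Hb, Hs in H; apply fake_square_iff in H.
rewrite Ha, Hx, Hv, Hc in Hax; apply invertible_square_pullback in Hax.
rewrite Hb, Hy, Hw, Hd in Hby; apply invertible_square_pullback in Hby.
(* A cone over the pullback of [y'] and [b'] whose apex is [J]; it induces the map [q] from [I] to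
   [J]. *)
assert (Hq : y' ∘ (r' ∘ c') = b' ∘ (t' ∘ v')).
{ rewrite <- !composeA, <- (proj1 Hbip), <- H, !composeA; f_equal; apply Hax. }
destruct (pullback_lift Hby Hq) as (q & Q1 & Q2).
assert (Mq : M q).
{ apply (right_class_cancel fs Mw); rewrite Q2; exact (wcl_comp (fs_right fs) Mt Mv). }
exists (lower_star HS pb Mq); split; [| split].
- exists q, Mq; reflexivity.
- change (lower_star HS pb Mq ⋅ c ≼ d ⋅ r).
  rewrite Hc, Hd, Hr; apply fake_square_iff; auto.
- rewrite Ht, Hw, Hv; apply lower_star_bipullback_iff.
  (* The wanted square pasted with the one on [b'] and [y'] has the same outer square as the pasting
     of the two given pullbacks. *)
  apply (pullback_cancel (pullback_sym Hby)); [rewrite Q1 | auto].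
  rewrite <- H.
  exact (pullback_paste Hbip (pullback_sym Hax)).
Qed.

Lemma Spn_V4 : fpr_V4 (E_upper_star HS pb) (M_lower_star HS pb).
Proof.
intros X Y Z D G F K I x u h a e f g k p c v
  (x' & Mx & Hx) (u' & Mu & Hu) (h' & Eh & Hh) (a' & Ea & Ha) (e' & Ee & He)
  (f' & Ef & Hf) (g' & Eg & Hg) H Hbip
  (k' & Ek & Hk) (p' & Mp & Hp) Hhu (c' & Ec & Hc) (v' & Mv & Hv) Hax.
fold (has_hom (x ⋅ e) (f ⋅ u)) in H.
rewrite Hg, Ha, Hh, Hf in Hbip; apply upper_star_bipullback_iff in Hbip.
rewrite Hx, He, Hf, Hu in H; apply fake_square_iff in H.
rewrite Ha, Hx, Hv, Hc in Hax; apply invertible_square_pullback in Hax.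
rewrite Hh, Hu, Hp, Hk in Hhu; apply invertible_square_pullback in Hhu.
assert (Hax' := span_legs_pushout Mx Ea Hax).
destruct (fs_fact fs (g' ∘ v')) as (N & l & n & El & Mn & Hln).
assert (Hsq : u' ∘ (e' ∘ c') = h' ∘ n ∘ l).
{ rewrite <- composeA, H, !composeA, (proj1 Hax), <- Hln, <- !composeA.
  f_equal; symmetry; apply Hbip. }
(* The diagonal [b] from [N] to [D] is the candidate for [k'], up to identifying [N] with [K]. *)
destruct (fs_orth fs El Mu Hsq) as (b & [B1 B2] & _).
destruct (sfs_2 HS l Ec) as (Q & i & j & HQ).
assert (Ej := left_class_pushout fs Ec HQ).
assert (Ei := left_class_pushout fs El (pushout_sym HQ)).
destruct (pushout_desc HQ (eq_sym B1)) as (t & T1 & T2).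
assert (Hout : is_pushout (n ∘ l) c' h' (f' ∘ x')).
{ rewrite <- Hln; exact (pushout_paste (pushout_sym Hax') Hbip). }
assert (Hn : is_pushout n j h' (u' ∘ t)).
{ apply (pushout_cancel (pushout_sym HQ)).
  - rewrite composeA, T1, H; exact Hout.
  - rewrite composeA, T2; symmetry; exact B2. }
(* [t ∘ i = e'] puts [t] in [E]. By (SFS4) the pushout [u' ∘ t] of [n] along [j] is in [M], so [t]
   is in [M] as well. *)
assert (It : is_iso t).
{ apply (left_right_is_iso fs).
  - apply (left_class_cancel (f := t) (e := i) fs Ei); rewrite T1; exact Ee.
  - apply (right_class_cancel fs Mu).
    exact (sfs_4 HS Ej Mn (pushout_sym Hn)). }
assert (HQD : is_pushout l c' b e').
{ rewrite <- T1, <- T2; exact (pushout_comp_iso It (pushout_sym HQ)). }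
assert (HND : is_pushout n b h' u').
{ apply (pushout_cancel HQD); [rewrite H; exact Hout | symmetry; exact B2]. }
assert (Eb : E b).
{ apply (left_class_cancel (f := b) (e := l) fs El); rewrite B1.
  exact (wcl_comp (fs_left fs) Ee Ec). }
(* (SFS5) turns the pushout [HND] into a pullback of [u'] and [h']. Since [K] carries another such
   pullback, there is an isomorphism [z] from [N] to [K], and the required 1-cell is the upper star
   of [z ∘ l]. *)
assert (Hpb : is_pullback u' h' b n).
{ apply pullback_sym, (sfs_5 HS Mn Mu Eb Eh); [symmetry; exact B2 | exact HND]. }
destruct (pullback_unique Hhu Hpb) as (z & Iz & Z1 & Z2).
assert (Ejl : E (z ∘ l)) by exact (wcl_comp (fs_left fs) (wcl_iso (fs_left fs) Iz) El).
exists (upper_star HS pb Ejl); split; [| split].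
- exists (z ∘ l), Ejl; reflexivity.
- rewrite Hc, Hk, He; apply upper_star_bipullback_iff.
  apply (pushout_move_iso Iz); rewrite Z1; exact HQD.
- change (v ⋅ upper_star HS pb Ejl ≼ g ⋅ p).
  rewrite Hv, Hg, Hp; apply fake_square_iff.
  rewrite <- composeA, Z2; auto.
Qed.

End Spans.

Theorem proposition9 (C : Category) (E M : mor_class C) (HS : suitable E M)
    (pb : pullback_choice E M) :
  fake_pullback_ready (S := Spn HS pb) (E_upper_star HS pb) (M_lower_star HS pb).
Proof.
split.
- apply Spn_locally_preordered.
- apply star_factorization_system.
- apply upper_star_bipullbacks.
- apply lower_star_bipullbacks.
- apply Spn_V2.
- apply Spn_V3.
- apply Spn_V4.
Qed.
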